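(* For every $p\in\mathbb Z$, the polynomial $C_p(E,Q)=E^{|p|}+\sum_{i=0}^{|p|-1}b_p(Q,i)E^i\in\mathbb Z[E,Q^{\pm1}]$ defined in the context is the $C$-polynomial of the twist knot $K_p$, i.e. it is the specialization at $q=1$ of the (monic in $E$) non-commutative $C$-polynomial of $K_p$.
   Context: **Operators.** A discrete function is a map $f:\mathbb N=\{0,1,2,\dots\}\to\mathbb Q(q)$. Operators act by $(Ef)(n)=f(n+1)$, $(Qf)(n)=q^nf(n)$, so $EQ=qQE$. Let $\mathcal A=\mathbb Q(q)\langle Q,E\rangle/(EQ-qQE)$ and $\mathcal A_{\mathrm{loc}}=\mathbb Q(q,Q)\langle E\rangle/(E\alpha(Q,q)-\alpha(qQ,q)E\mid\alpha\in\mathbb Q(Q,q))$, a (left) principal ideal domain. For a discrete function $f$ let $I_f=\{P\in\mathcal A\mid Pf=0\}$. The characteristic polynomial of $f$ is a generator $P_f(E,Q,q)$ of the left ideal of $\mathcal A_{\mathrm{loc}}$ generated by $I_f$ (unique up to left multiplication by a nonzero element of $\mathbb Q(q,Q)$). **$C$-polynomial.** For a knot $K$, $J_K(n)\in\mathbb Z[q^{\pm1}]$ ($n\ge1$) is the colored Jones function (color: the $n$-dimensional irreducible representation of $\mathfrak{sl}_2$; value $1$ on the unknot). The cyclotomic function $\hat J_K:\mathbb N\to\mathbb Z[q^{\pm1}]$ is determined by $J_K(n)=\sum_{k\ge0}C(n,k)\hat J_K(k)$ for $n\ge 1$, with $C(n,k)=\{n-k\}\cdots\{n-1\}\{n+1\}\cdots\{n+k\}$,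 $\{a\}=q^{a/2}-q^{-a/2}$. The non-commutative $C$-polynomial $C_K(E,Q,q)$ is the characteristic polynomial of $\hat J_K$, and the $C$-polynomial is $C_K(E,Q)=C_K(E,Q,1)$. For twist knots the non-commutative $C$-polynomial is normalized to be monic in $E$; it then has coefficients in $\mathbb Z[Q^{\pm1},q^{\pm1}]$. **Twist knots.** $K_p$ ($p\in\mathbb Z$) is the twist knot with $p$ full twists and a negative clasp; $K_0$ is the unknot, $K_1=3_1$, $K_2=5_2$, $K_{-1}=4_1$, $K_{-2}=6_1$. It is known (Masbaum) that its cyclotomic function is $$\hat J_p(n)=\sum_{k=0}^{n}q^{n(n+3)/2+pk(k+1)+k(k-1)/2}(-1)^{n+k+1}\frac{(q^{2k+1}-1)(q;q)_n}{(q;q)_{n+k+1}(q;q)_{n-k}},$$ with $(q;q)_m=(1-q)\cdots(1-q^m)$ and $(q;q)_0=1$. **Coefficients $b_p(Q,i)$, $0\le i\le|p|-1$** (there are none for $p=0$, so $C_0=1$). If $p>0$: $$b_p(Q,i)=Q^{p-i}(1-Q)^{p-i-1}\Big(\sum_{j=0}^{i}Q^{2j}\binom{p-j}{p-i}\binom{p-i+j-1}{j}-\sum_{j=0}^{i-1}Q^{2j+1}\binom{p-j-1}{p-i}\binom{p-i+j-1}{j}\Big).$$ If $p<0$: $$b_p(Q,i)=Q^{p-i+1}(1-Q)^{-p-i-1}\Big(-\sum_{j=0}^{i}Q^{2j}\binom{-p-j-1}{i-j}\binom{-p-i+j}{j}+\sum_{j=0}^{i-1}Q^{2j+1}\binom{-p-j-2}{i-j-1}\binom{-p-i+j}{j}\Big).$$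 *)

(* Defs.v *)
From HB Require Import structures.
From mathcomp Require Import all_boot all_order all_algebra.
From mathcomp Require Import generic_quotient.

Set Implicit Arguments.
Unset Strict Implicit.
Unset Printing Implicit Defensive.

Import Order.TTheory GRing.Theory Num.Theory.
Local Open Scope ring_scope.

(* [skew_poly s] is the Ore extension R<E> / (E a - s(a) E): the element       *)
(* \sum_i a_i E^i, coefficients on the left, is stored as the polynomial with  *)
(* coefficients a_i.  It shares the additive structure of {poly R}, but its    *)
(* ring product is [skew_mul].                                                 *)
Definition skew_poly (R : nzRingType) (s : {rmorphism R -> R}) := {poly R}.

Section SkewPoly.

Variables (R : nzRingType) (s : {rmorphism R -> R}).

HB.instance Definition _ := GRing.Zmodule.copy (skew_poly s) {poly R}.

Definition skew_mul (f g : {poly R}) : {poly R} :=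
  \sum_(i < size f) f`_i *: (map_poly (iter i s) g * 'X^i).

Let T i (g : {poly R}) := map_poly (iter i s) g * 'X^i.

Let iter_s0 i : iter i s 0 = 0.
Proof. by elim: i => //= i ->; rewrite rmorph0. Qed.

Let iter_s1 i : iter i s 1 = 1.
Proof. by elim: i => //= i ->; rewrite rmorph1. Qed.

Let iter_sD i a b : iter i s (a + b) = iter i s a + iter i s b.
Proof. by elim: i => //= i ->; rewrite rmorphD. Qed.

Let iter_sM i a b : iter i s (a * b) = iter i s a * iter i s b.
Proof. by elim: i => //= i ->; rewrite rmorphM. Qed.

Let coefT i g k : (T i g)`_k = if (k < i)%N then 0 else iter i s g`_(k - i).
Proof. by rewrite coefMXn coef_map_id0. Qed.

Let TD i g h : T i (g + h) = T i g + T i h.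
Proof.
by apply/polyP => k; rewrite coefD !coefT coefD iter_sD; case: ifP; rewrite ?addr0.
Qed.

Let TZ i a g : T i (a *: g) = iter i s a *: T i g.
Proof.
by apply/polyP => k; rewrite coefZ !coefT coefZ iter_sM; case: ifP; rewrite ?mulr0.
Qed.

Let TT i j g : T i (T j g) = T (i + j) g.
Proof.
apply/polyP => k; rewrite !coefT; case: ltnP => [ki|ik].
  by rewrite (leq_trans ki (leq_addr _ _)).
rewrite ltn_subLR //; case: ifP => _; first exact: iter_s0.
by rewrite iterD // subnDA.
Qed.

Let T0 g : T 0 g = g.
Proof. by apply/polyP => k; rewrite coefT /= subn0. Qed.

Let Tsum i n (F : 'I_n -> {poly R}) : T i (\sum_j F j) = \sum_j T i (F j).
Proof.
apply: (big_morph (T i) (TD i)).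
by apply/polyP => k; rewrite coefT !coef0 iter_s0 if_same.
Qed.

Let skew_mul_widen n (f g : {poly R}) :
  (size f <= n)%N -> skew_mul f g = \sum_(i < n) f`_i *: T i g.
Proof.
move=> fn; rewrite /skew_mul (big_ord_widen n (fun i => f`_i *: T i g) fn).
rewrite big_mkcond; apply: eq_bigr => i _; case: ltnP => // fi.
by rewrite nth_default // scale0r.
Qed.

Let skew_mulDl : left_distributive skew_mul +%R.
Proof.
move=> f g h; set n := maxn (size f) (size g).
rewrite (@skew_mul_widen n f) ?leq_maxl // (@skew_mul_widen n g) ?leq_maxr //.
rewrite (@skew_mul_widen n) ?size_polyD // -big_split /=.
by apply: eq_bigr => i _; rewrite coefD scalerDl.
Qed.

Let skew_mulDr : right_distributive skew_mul +%R.
Proof.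
move=> f g h; rewrite /skew_mul -big_split /=.
by apply: eq_bigr => i _; rewrite -/(T i _) TD scalerDr.
Qed.

Let skew_mul1l : left_id 1 skew_mul.
Proof.
by move=> f; rewrite /skew_mul size_poly1 big_ord1 coef1 scale1r -/(T 0 f) T0.
Qed.

Let skew_mul1r : right_id 1 skew_mul.
Proof.
move=> f; rewrite -[RHS]coefK poly_def; apply: eq_bigr => i _.
congr (_ *: _); apply/polyP => k; rewrite -/(T i 1) coefT coefXn coef1.
case: ltngtP => [ki|ik|->].
- by [].
- by rewrite subn_eq0 leqNgt ik /= iter_s0.
- by rewrite subnn iter_s1.
Qed.

Let skew_mulZT a i g h : skew_mul (a *: T i g) h = a *: T i (skew_mul g h).
Proof.
rewrite (@skew_mul_widen (i + size g)); last first.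
  apply: (leq_trans (size_scale_leq _ _)); apply/leq_sizeP => k igk.
  rewrite coefT; case: ifP => // _.
  by rewrite nth_default ?iter_s0 // leq_subRL // (leq_trans (leq_addr _ _) igk).
rewrite big_split_ord /= big1 ?add0r => [|k _]; last first.
  by rewrite coefZ coefT ltn_ord mulr0 scale0r.
rewrite Tsum scaler_sumr; apply: eq_bigr => j _.
rewrite coefZ coefT ltnNge leq_addr /= addKn -/(T j h) TZ TT.
by rewrite -!scalerA.
Qed.

Let skew_mulA : associative skew_mul.
Proof.
move=> f g h; have mul0 : skew_mul 0 h = 0.
  by rewrite /skew_mul size_poly0 big_ord0.
rewrite [skew_mul f g]/skew_mul.
rewrite (big_morph (skew_mul^~ h) (fun a b => skew_mulDl a b h) mul0).
by apply: eq_bigr => i _; rewrite -/(T _ _) -/(T _ _) skew_mulZT.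
Qed.

HB.instance Definition _ := GRing.Zmodule_isNzRing.Build (skew_poly s)
  skew_mulA skew_mul1l skew_mul1r skew_mulDl skew_mulDr (oner_neq0 {poly R}).

Lemma skew_mulE (f g : skew_poly s) : f * g = skew_mul f g.
Proof. by []. Qed.

Lemma skewXC (a : R) :
  ('X : skew_poly s) * (a%:P : skew_poly s)
    = ((s a)%:P : skew_poly s) * ('X : skew_poly s).
Proof.
rewrite !skew_mulE (@skew_mul_widen 2) ?size_polyX //.
rewrite (@skew_mul_widen 1) ?size_polyC_leq1 // !big_ord_recl !big_ord0 /=.
rewrite -[bump 0 0]/1%N !coefX coefC /= scale0r scale1r add0r !addr0 T0 /T /=.
by rewrite (map_polyC s) expr1 mul_polyC.
Qed.

End SkewPoly.

Local Notation tofrac := (@FracField.tofrac _).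

(* The extension to {fraction R} of a ring endomorphism of R; it is only       *)
(* meaningful (and only a ring morphism) when the endomorphism is injective.   *)
Section FracMap.

Variables (R : idomainType) (s : {rmorphism R -> R}).

Lemma frac_repr (x : {fraction R}) : x = tofrac (repr x).1 / tofrac (repr x).2.
Proof.
rewrite -[LHS]reprK; move: (repr x) => r; unlock FracField.tofrac.
rewrite -[X in _ * X]FracField.pi_inv -[RHS]FracField.pi_mul.
congr (\pi_(_) _)%qT; rewrite /FracField.mulf /FracField.invf /=.
have r2 := denom_ratioP r.
by rewrite !numden_Ratio ?oner_neq0 // mulr1 mul1r Ratio_numden.
Qed.

Definition frac_map (x : {fraction R}) : {fraction R} :=
  tofrac (s (repr x).1) / tofrac (s (repr x).2).

Hypothesis s_eq0 : forall a, (s a == 0) = (a == 0).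

Lemma frac_map_div a b : b != 0 ->
  frac_map (tofrac a / tofrac b) = tofrac (s a) / tofrac (s b).
Proof.
move=> b0; rewrite /frac_map; set x := tofrac a / tofrac b.
have /eqP := frac_repr x.
have d0 : (repr x).2 != 0 by exact: denom_ratioP.
rewrite eqr_div ?tofrac_eq0 // -!tofracM tofrac_eq => /eqP e.
by apply/eqP; rewrite eqr_div ?tofrac_eq0 ?s_eq0 // -!tofracM -!rmorphM -e mulrC.
Qed.

Lemma frac_map_is_zmod_morphism : zmod_morphism frac_map.
Proof.
move=> x y; have x0 : (repr x).2 != 0 by exact: denom_ratioP.
have y0 : (repr y).2 != 0 by exact: denom_ratioP.
rewrite [in LHS](frac_repr x) [in LHS](frac_repr y) -mulNr.
rewrite addf_div ?tofrac_eq0 // mulNr -!tofracM -tofracB.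
rewrite frac_map_div ?mulf_neq0 // /frac_map -[in RHS]mulNr.
rewrite [in RHS]addf_div ?tofrac_eq0 ?s_eq0 // [in RHS]mulNr -!tofracM -tofracB.
by rewrite rmorphB !rmorphM.
Qed.

Lemma frac_map_is_monoid_morphism : monoid_morphism frac_map.
Proof.
split=> [|x y].
  rewrite -[X in frac_map X]divr1 -tofrac1 frac_map_div ?oner_neq0 //.
  by rewrite !rmorph1 divr1.
have x0 : (repr x).2 != 0 by exact: denom_ratioP.
have y0 : (repr y).2 != 0 by exact: denom_ratioP.
rewrite [in LHS](frac_repr x) [in LHS](frac_repr y) mulf_div -!tofracM.
by rewrite frac_map_div ?mulf_neq0 // /frac_map mulf_div !rmorphM.
Qed.

End FracMap.

Notation Qq := {fraction {poly rat}}.   (* Q(q) *)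
Notation QqQ := {fraction {poly Qq}}.   (* Q(q,Q) *)
Notation QQ := {fraction {poly rat}}.   (* Q(Q), the target at q = 1 *)

Definition q_ : Qq := tofrac 'X.
Definition Q_ : QQ := tofrac 'X.

Lemma q_neq0 : q_ != 0.
Proof. by rewrite tofrac_eq0 polyX_eq0. Qed.

(* alpha(Q) |-> alpha(q Q), on polynomials and then on rational functions *)
Definition qshift : {rmorphism {poly Qq} -> {poly Qq}} := comp_poly (q_ *: 'X).

Lemma qshift_eq0 (a : {poly Qq}) : (qshift a == 0) = (a == 0).
Proof. by rewrite comp_poly2_eq0 // size_scale ?q_neq0 // size_polyX. Qed.

Definition qshift_frac : QqQ -> QqQ := frac_map qshift.

HB.instance Definition _ := GRing.isZmodMorphism.Build QqQ QqQ qshift_frac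
  (frac_map_is_zmod_morphism qshift_eq0).
HB.instance Definition _ := GRing.isMonoidMorphism.Build QqQ QqQ qshift_frac
  (frac_map_is_monoid_morphism qshift_eq0).

(* The q-Weyl algebra Q(q)<Q,E>/(EQ - qQE) and its localization.  An element   *)
(* of [Aq] is \sum_(i,j) c_ij Q^j E^i with c_ij = P`_i`_j.                     *)
Definition Aq := skew_poly qshift.
Definition Aloc := skew_poly qshift_frac.

Lemma Aq_EQ :
  ('X : Aq) * ('X%:P : Aq) = ((q_ *: 'X)%:P : Aq) * ('X : Aq).
Proof. by rewrite skewXC /= comp_polyX. Qed.

Lemma Aloc_Ealpha (alpha : QqQ) :
  ('X : Aloc) * (alpha%:P : Aloc) = ((qshift_frac alpha)%:P : Aloc) * ('X : Aloc).
Proof. exact: skewXC. Qed.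

Definition Aq_loc (P : Aq) : Aloc := map_poly tofrac P.

Definition opE (f : nat -> Qq) : nat -> Qq := fun n => f n.+1.
Definition opQ (f : nat -> Qq) : nat -> Qq := fun n => q_ ^+ n * f n.

Definition act (P : Aq) (f : nat -> Qq) (n : nat) : Qq :=
  \sum_(i < size P) \sum_(j < size P`_i) P`_i`_j * iter j opQ (iter i opE f) n.

Definition annihilates (f : nat -> Qq) (P : Aq) : Prop :=
  forall n, act P f n = 0.

Definition generated_left_ideal (A : nzRingType) (S : A -> Prop) (x : A) : Prop :=
  exists m (l s : 'I_m -> A),
    (forall k, S (s k)) /\ x = \sum_(k < m) l k * s k.

Definition extended_annihilator (f : nat -> Qq) : Aloc -> Prop :=
  generated_left_ideal (fun R => exists2 P, annihilates f P & R = Aq_loc P).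

Definition is_characteristic_polynomial (f : nat -> Qq) (C : Aloc) : Prop :=
  forall R, extended_annihilator f R <-> exists L : Aloc, R = L * C.

(* [laurent_eval N a b Q q] is N(Q,q) Q^a q^b.  Every element of              *)
(* Z[Q^{+-1},q^{+-1}] has this form, with N a polynomial in Q whose            *)
(* coefficients are polynomials in q.                                          *)
Definition laurent_eval (F : fieldType) (N : {poly {poly int}}) (a b : int)
    (Q q : F) : F :=
  (map_poly (map_poly intr) N).[Q, q] * Q ^ a * q ^ b.

(* [specializes_at_q1 c d]: the rational function c(Q,q) belongs to            *)
(* Z[Q^{+-1},q^{+-1}] and d(Q) = c(Q,1).  The value of d does not depend on    *)
(* the representation (N, a, b) of c, as Q and q are algebraically independent *)
(* in Q(q,Q).                                                                  *)
Definition specializes_at_q1 (c : QqQ) (d : QQ) : Prop :=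
  exists (N : {poly {poly int}}) (a b : int),
    c = laurent_eval N a b (tofrac 'X) (tofrac q_%:P)
    /\ d = laurent_eval N a b Q_ 1.

(* [c], a polynomial in E over Q(Q), is the specialization at q = 1 of the     *)
(* characteristic polynomial of [f], normalized to be monic in E (which        *)
(* determines it) and having coefficients in Z[Q^{+-1},q^{+-1}].               *)
Definition is_C_polynomial (f : nat -> Qq) (c : {poly QQ}) : Prop :=
  exists C : Aloc,
    [/\ is_characteristic_polynomial f C,
        lead_coef C = 1
      & forall i, specializes_at_q1 C`_i c`_i].

Definition qpochhammer (m : nat) : Qq := \prod_(1 <= j < m.+1) (1 - q_ ^+ j).

(* The cyclotomic function of the twist knot K_p with p full twists and a      *)
(* negative clasp, by Masbaum's formula.                                       *)
Definition twist_cyclotomic (p : int) (n : nat) : Qq :=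
  \sum_(k < n.+1)
    q_ ^ (((n * (n + 3)) %/ 2)%N%:Z + p * (k * (k + 1))%N%:Z
          + ((k * (k - 1)) %/ 2)%N%:Z)
    * (-1) ^+ (n + k + 1)
    * (((q_ ^+ (2 * k + 1) - 1) * qpochhammer n)
       / (qpochhammer (n + k + 1) * qpochhammer (n - k))).

(* All the natural-number subtractions below are exact for i < |p|, which is   *)
(* the only range used.                                                        *)
Definition twist_b_pos (p i : nat) : QQ :=
  Q_ ^+ (p - i) * (1 - Q_) ^+ (p - i - 1)
  * (\sum_(j < i.+1)
        Q_ ^+ (2 * j) * 'C(p - j, p - i)%:R * 'C(p - i + j - 1, j)%:R
     - \sum_(j < i)
        Q_ ^+ (2 * j + 1) * 'C(p - j - 1, p - i)%:R * 'C(p - i + j - 1, j)%:R).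

(* The coefficient b_{-m}(Q,i), for m > 0. *)
Definition twist_b_neg (m i : nat) : QQ :=
  Q_ ^ (- m%:Z - i%:Z + 1) * (1 - Q_) ^+ (m - i - 1)
  * (- (\sum_(j < i.+1)
          Q_ ^+ (2 * j) * 'C(m - j - 1, i - j)%:R * 'C(m - i + j, j)%:R)
     + \sum_(j < i)
        Q_ ^+ (2 * j + 1) * 'C(m - j - 2, i - j - 1)%:R * 'C(m - i + j, j)%:R).

Definition twist_b (p : int) (i : nat) : QQ :=
  if 0 < p then twist_b_pos `|p| i else twist_b_neg `|p| i.

(* The commutative variable E is 'X. *)
Definition twist_C (p : int) : {poly QQ} :=
  'X^`|p| + \sum_(i < `|p|) twist_b p i *: 'X^i.

(* Main.v *)
Require Import Defs.
From HB Require Import structures.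
From mathcomp Require Import all_boot all_order all_algebra all_field.
From mathcomp Require Import generic_quotient ring zify.

Set Implicit Arguments.
Unset Strict Implicit.
Unset Printing Implicit Defensive.

Import Order.TTheory GRing.Theory Num.Theory.
Local Open Scope ring_scope.
Local Notation tofrac := (@FracField.tofrac _).

(** Write E and Q for the operators of the q-Weyl algebra, and for m >= 0 let
    h_m(n) be Masbaum's sum for the twist knot K_m without the prefactor
    (-1)^n q^(n(n+3)/2).  Termwise, replacing q by its inverse turns h_m into the
    cyclotomic function of K_(-m).  So everything is reduced to h_m, for which
    two things are needed: a recurrence of order m with the right value at q = 1,
    and its minimality.

    Recurrence.  The function n |-> (q)_n / ((q)_(n+k+1) (q)_(n-k)) is an
    eigenfunction, with eigenvalue q^(k+1) + q^(-k), of a first order operator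
    in E^-1, here called [casimir].  The operators R_0 = 1,
    R_1 = Q^-1 (1 - E^-1), R_(j+2) = R_(j+1) casimir - q R_j therefore multiply this
    function by a factor that satisfies, in j, a second order recurrence with
    constant coefficients and has a closed form ([twist_op_kernel]).  Inserting it for
    j = m in h_m, one gets a telescoping sum, whence R_m h_m = 0
    ([masbaum_rec]).  At q = 1 the coefficients of R_m satisfy a commutative
    three-term recurrence, also satisfied by the binomial sums in b_p
    ([twist_coef_binomial]).

    Minimality.  Let B be a nonzero annihilator of h_m of minimal order d.
    Pseudo-division gives g C = A B, where C is R_m with its denominators
    cleared.  After clearing powers of q - 1, setting q = 1 makes the algebra
    commutative, and C becomes a polynomial in E over Q[Q] that is irreducible
    over Q(Q) ([classical_twist_irreducible]); hence d = 0 or d = m.  The first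
    case is impossible because h_m does not vanish eventually: R_m can be solved
    for its last term, and h_m(0) = 1.

    Irreducibility.  The substitution E = (Q - 1)/G and reversal turn C at q = 1
    into T_m(G, Q), up to powers of Q - 1, where T_0 = 1 - Q, T_1 = G + 1 - Q and
    T_(k+2) = (G + 1 + Q^2) T_(k+1) - Q^2 T_k.  With G of weight 2 and Q of
    weight 1, the top part of T_m is G (G + Q^2)^(m-1), while T_m(0, Q) = 1 - Q.
    If T_m = A B, the simple factor G divides the top part of only one factor,
    say not that of A; then A(0, Q) has the full weight of A, at least
    twice its degree in G, but A(0, Q) divides 1 - Q and has degree at most 1.  So
    A has degree 0 in G ([T_irreducible]). *)

(** * The coefficients of the recurrence *)

(** With R_0 = 1, R_1 = Q^-1 (1 - E^-1) and R_(k+2) = R_(k+1) L - q R_k, where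
    L = Q^-1 (1 + q Q^2 - (1 - Q) E^-1), this is the coefficient of E^-i in R_k,
    multiplied by Q^k q^(ik) so that it is a polynomial in Q and q. *)
Fixpoint twist_coef (R : comNzRingType) (Q q : R) (k i : nat) : R :=
  match k with
  | 0 => (i == 0)%:R
  | k1.+1 => match k1 with
    | 0 => if i is i1.+1 then if i1 is _.+1 then 0 else - q else 1
    | k2.+1 =>
      (q ^+ (2 * i) + q * Q ^+ 2) * twist_coef Q q k1 i
      - (if i is i1.+1 then q ^+ (i + k1) * (q ^+ i1 - Q) * twist_coef Q q k1 i1 else 0)
      - q ^+ (2 * i).+1 * Q ^+ 2 * twist_coef Q q k2 i
    end
  end.

Lemma twist_coefSS (R : comNzRingType) (Q q : R) k i :
  twist_coef Q q k.+2 i.+1 = (q ^+ (2 * i.+1) + q * Q ^+ 2) * twist_coef Q q k.+1 i.+1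
      - q ^+ (i.+1 + k.+1) * (q ^+ i - Q) * twist_coef Q q k.+1 i
      - q ^+ (2 * i.+1).+1 * Q ^+ 2 * twist_coef Q q k i.+1.
Proof. by []. Qed.

Lemma twist_coef0 (R : comNzRingType) (Q q : R) k : twist_coef Q q k 0 = 1.
Proof.
elim/ltn_ind: k => -[|[|k]] IH //.
have -> : twist_coef Q q k.+2 0 = (1 + q * Q ^+ 2) * twist_coef Q q k.+1 0 - 0
  - q ^+ 1 * Q ^+ 2 * twist_coef Q q k 0 by [].
by rewrite !IH //; ring.
Qed.

Arguments twist_coef : simpl never.

Lemma twist_coef_gt (R : comNzRingType) (Q q : R) k i : (k < i)%N -> twist_coef Q q k i = 0.
Proof.
elim/ltn_ind: k i => -[|[|k]] IH [|i] //; first by case: i.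
move=> ki; have k1i : (k.+1 < i)%N := ki.
have ki1 : (k < i.+1)%N by apply: (ltn_trans (ltnSn k)); apply: ltnW.
by rewrite twist_coefSS !IH // ?mulr0 ?subr0 // ltnW.
Qed.

(** Over a field and for q nonzero, the trailing coefficient vanishes only at
    Q = q^j with 0 < j < k + 1; this is what allows the recurrence to be run backwards. *)
Lemma twist_coef_diag (R : comNzRingType) (Q q : R) k :
  twist_coef Q q k.+1 k.+1 = (- q) ^+ k.+1 * \prod_(j < k) (q ^+ (2 * j.+1) * (q ^+ j.+1 - Q)).
Proof.
elim: k => [|k IH]; first by rewrite big_ord0 mulr1 expr1.
rewrite twist_coefSS (twist_coef_gt _ _ (ltnSn _)) (@twist_coef_gt _ _ _ k) // IH big_ord_recr /=.
rewrite [(- q) ^+ k.+2]exprS.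
have -> : (k.+2 + k.+1 = (2 * k.+1).+1)%N by rewrite mul2n -addnn addSn.
rewrite [q ^+ (2 * k.+1).+1]exprS.
move: (\prod_(j < k) _) ((- q) ^+ k.+1) (q ^+ k.+1) (q ^+ (2 * k.+1)) => P a b c.
by ring.
Qed.

Lemma twist_coef_morph (R S : comNzRingType) (f : {rmorphism R -> S}) (Q q : R) k i :
  f (twist_coef Q q k i) = twist_coef (f Q) (f q) k i.
Proof.
elim/ltn_ind: k i => -[|[|k]] IH [|i]; rewrite ?twist_coef0 ?rmorph1 //.
- by rewrite rmorph0.
- case: i => [|i]; [exact: rmorphN | exact: rmorph0].
by rewrite !twist_coefSS !(rmorphB, rmorphD, rmorphXn, rmorphM) !IH.
Qed.

(** * The recurrence of the Masbaum sum *)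

Definition qpoch (F : fieldType) (q : F) (m : nat) : F := \prod_(1 <= j < m.+1) (1 - q ^+ j).

(** The cyclotomic function of the twist knot with m full twists, stripped of
    (-1)^n q^(n(n+3)/2).  It is defined over any field, so that it can also be used
    at the inverse of q and transported by field morphisms. *)
Definition masbaum_sum (F : fieldType) (q : F) (m n : nat) : F :=
  \sum_(k < n.+1) (-1) ^+ k * q ^+ (m * (k * (k + 1)) + (k * (k - 1)) %/ 2)
    * (1 - q ^+ (2 * k + 1)) * (qpoch q n / (qpoch q (n + k + 1) * qpoch q (n - k))).

Section Recursion.
Variables (F : fieldType) (q : F).
Hypothesis q0 : q != 0.
Hypothesis q1 : forall k, q ^+ k.+1 != 1.
Local Notation qp := (qpoch q).

Lemma qpS m : qp m.+1 = qp m * (1 - q ^+ m.+1).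
Proof. by rewrite /qpoch big_nat_recr. Qed.

Lemma qp0 : qp 0 = 1.
Proof. by rewrite /qpoch big_geq. Qed.

Lemma subX_neq0 k : 1 - q ^+ k.+1 != 0.
Proof. by rewrite subr_eq0 eq_sym. Qed.

Lemma qp_neq0 m : qp m != 0.
Proof. by elim: m => [|m IH]; rewrite ?qp0 ?oner_neq0 // qpS mulf_neq0 ?subX_neq0. Qed.

Lemma expr_sub_neq0 n k : q ^+ (n + k.+1) - q ^+ n != 0.
Proof.
by rewrite exprD -[Z in _ - Z]mulr1 -mulrBr mulf_neq0 ?expf_neq0 // subr_eq0 q1.
Qed.

Definition bailey_kernel k n := if (k <= n)%N then qp n / (qp (n + k + 1) * qp (n - k)) else 0.

(** At n = 0 the junk value g 0 that stands for g (-1) is multiplied by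
    1 - q^0 = 0. *)
Definition casimir (g : nat -> F) n :=
  (q ^+ n)^-1 * ((1 + q ^+ (2 * n + 1)) * g n - (1 - q ^+ n) * g n.-1).

(** This is the expansion of (1 - q^(n+k+1)) (1 - q^(n-k)) in powers of q^n:
    multiplying the kernel at n by this product gives 1 - q^n times the kernel at
    n - 1, and the only dependence on k is through q^(k+1) + q^(-k). *)
Lemma casimir_kernel k n : casimir (bailey_kernel k) n = (q ^+ k.+1 + (q ^+ k)^-1) * bailey_kernel k n.
Proof.
rewrite /casimir /bailey_kernel; case: (ltngtP k n) => [kn|nk|<-].
- have {kn} [d ->] : exists d, n = (k + d).+1 by exists (n - k.+1)%N; lia.
  rewrite /= leq_addr.
  have -> : ((k + d).+1 - k = d.+1)%N by lia.
  have -> : ((k + d) - k = d)%N by lia.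
  have -> : ((k + d).+1 + k + 1 = (2 * k + d + 1).+1)%N by lia.
  have -> : ((k + d) + k + 1 = 2 * k + d + 1)%N by lia.
  rewrite !qpS.
  have := qp_neq0 d; have := qp_neq0 (k + d); have := qp_neq0 (2 * k + d + 1).
  have := subX_neq0 d; have := subX_neq0 (2 * k + d + 1).
  have := subX_neq0 (k + d).
  have -> : q ^+ (2 * (k + d).+1 + 1) = (q ^+ k * q ^+ d * q) ^+ 2 * q.
    by rewrite -!exprD -!exprSr -exprM -exprSr; congr (_ ^+ _); lia.
  have -> : q ^+ (2 * k + d + 1).+1 = q ^+ k * q ^+ d * q ^+ k * q ^+ 2.
    by rewrite -!exprD; congr (_ ^+ _); lia.
  have -> : q ^+ (k + d).+1 = q ^+ k * q ^+ d * q by rewrite exprSr exprD.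
  rewrite !exprSr.
  have := expf_neq0 k q0; have := expf_neq0 d q0.
  move: (q ^+ k) (q ^+ d) (qp d) (qp (k + d)) (qp (2 * k + d + 1)).
  move=> a b c e f b0 a0 n1 + n3 f0 e0 c0.
  by rewrite expr0 mul1r => n2; field; rewrite n3 c0 n2 f0 a0 q0 b0.
- rewrite mulr0; have -> : (k <= n.-1)%N = false by lia.
  by rewrite !mulr0 subr0 mulr0.
- have -> : (1 - q ^+ k) * (if (k <= k.-1)%N then qp k.-1 / (qp (k.-1 + k + 1) *
     qp (k.-1 - k)) else 0) = 0.
    by case: k => [|k]; rewrite ?subrr ?mul0r //= ltnn mulr0.
  rewrite subr0 [LHS]mulrA; congr (_ * _).
  have -> : q ^+ (2 * k + 1) = (q ^+ k) ^+ 2 * q by rewrite -exprM mulnC exprD.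
  rewrite [q ^+ k.+1]exprSr; field.
  by rewrite expf_neq0.
Qed.

(** The operator Q^j R_j, for the R_j defined with [twist_coef]. *)
Definition twist_op j (g : nat -> F) n :=
  \sum_(i < j.+1) q ^- (i * j) * twist_coef (q ^+ n) q j i * g (n - i)%N.

Lemma twist_op_widen N j g n : (j < N)%N ->
  twist_op j g n = \sum_(i < N) q ^- (i * j) * twist_coef (q ^+ n) q j i * g (n - i)%N.
Proof.
move=> jN; rewrite /twist_op (big_ord_widen N (fun i => q ^- (i * j) * twist_coef (q ^+ n) q j i * g (n - i)%N)) //.
rewrite big_mkcond; apply: eq_bigr => i _; case: ltnP => // ij.
by rewrite twist_coef_gt // mulr0 mul0r.
Qed.

(** The definition of [twist_coef] is the right multiplication by [casimir] read
    on coefficients, using E^-1 Q = q^-1 Q E^-1.  The bound on n keeps every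
    argument n - i exact. *)
Lemma twist_op_rec j g n : (j.+2 <= n)%N ->
  twist_op j.+2 g n = q ^+ n * twist_op j.+1 (casimir g) n - q * (q ^+ n) ^+ 2 * twist_op j g n.
Proof.
move=> jn; have [j3 j23] : (j < j.+3)%N /\ (j.+1 < j.+3)%N by lia.
rewrite (twist_op_widen _ _ j3) (twist_op_widen _ _ j23) {1}/twist_op.
(* The part of the recurrence that lowers the second index is reindexed by one, so
   that both sides can be compared term by term. *)
pose G (i : nat) := q ^- (i * j.+1) * twist_coef (q ^+ n) q j.+1 i * (q ^+ i - q ^+ n) * g (n - i.+1)%N.
have -> : \sum_(i < j.+3) q ^- (i * j.+2) * twist_coef (q ^+ n) q j.+2 i * g (n - i)%N
 = \sum_(i < j.+3) ((q ^- (i * j.+2) * ((q ^+ (2 * i) + q * (q ^+ n) ^+ 2) * twist_coef (q ^+ n) q j.+1 i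
      - q ^+ (2 * i).+1 * (q ^+ n) ^+ 2 * twist_coef (q ^+ n) q j i)) * g (n - i)%N)
   - \sum_(i < j.+3) G i.
  rewrite [Z in _ - Z]big_ord_recr /= {2}/G twist_coef_gt // mulr0 !mul0r addr0.
  rewrite big_ord_recl [in RHS]big_ord_recl -addrA -sumrB; congr (_ + _).
    by congr (_ * _); rewrite !twist_coef0; ring.
  apply: eq_bigr => i _; rewrite !lift0 twist_coefSS /G.
  have -> : q ^- (i.+1 * j.+2) = q ^- (i * j.+1) * q ^- (i.+1 + j.+1).
    by rewrite -invfM -exprD; congr (_ ^- _); lia.
  have: q ^+ (i.+1 + j.+1) != 0 by rewrite expf_neq0.
  have: q ^+ (i * j.+1) != 0 by rewrite expf_neq0.
  move: (q ^+ (i * j.+1)) (q ^+ (i.+1 + j.+1)) => a b a0 b0; field.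
  by rewrite a0 b0.
rewrite mulr_sumr mulr_sumr -!sumrB; apply: eq_bigr => -[i /= ij] _.
rewrite /G /casimir -subnS.
have -> : q ^+ (2 * (n - i) + 1) = (q ^+ n / q ^+ i) ^+ 2 * q.
  rewrite expr_div_n -!exprM mulrAC -exprSr; apply/(canRL (mulfK _)); first by rewrite expf_neq0.
  by rewrite -exprD; congr (_ ^+ _); lia.
have -> : q ^+ (n - i) = q ^+ n / q ^+ i.
  by apply/(canRL (mulfK _)); rewrite ?expf_neq0 // -exprD subnK // (leq_trans _ jn).
have -> : q ^- (i * j.+2) = q ^- (i * j) / (q ^+ i) ^+ 2.
  by rewrite -exprM -invfM -exprD; congr (_ ^- _); lia.
have -> : q ^- (i * j.+1) = q ^- (i * j) / q ^+ i.
  by rewrite -invfM -exprD; congr (_ ^- _); lia.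
have -> : q ^+ (2 * i).+1 = (q ^+ i) ^+ 2 * q by rewrite exprSr mulnC exprM.
have -> : q ^+ (2 * i) = (q ^+ i) ^+ 2 by rewrite mulnC exprM.
have := expf_neq0 i q0; have := expf_neq0 n q0; have := expf_neq0 (i * j) q0.
move: (q ^+ i) (q ^+ n) (q ^+ (i * j)) => a b c c0 b0 a0.
by field; rewrite a0 b0 c0.
Qed.

Lemma twist_op_lin j c g g' n : (forall n, g n = c * g' n) -> twist_op j g n = c * twist_op j g' n.
Proof. by move=> E; rewrite /twist_op mulr_sumr; apply: eq_bigr => i _; rewrite E; ring. Qed.

(** The closed form A x^j + B (q/x)^j, for x = q^(-k), of the solution of
    r_(j+2) = (x + q/x) r_(j+1) - q r_j with r_0 = 1 - q^n and
    r_1 = x + q/x - 1 - q^(n+1), multiplied by 1 - q^(2k+1). *)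
Definition kernel_factor k n j : F :=
  (q ^+ k) ^- j * (1 - q ^+ k) * (1 - q ^+ (n + k + 1))
  + q ^+ (k.+1 * j + k) * (1 - q ^+ k.+1) * (1 - q ^+ n / q ^+ k).

(** [casimir] acts on the kernel by a scalar, so the operator recurrence becomes the
    scalar recurrence solved by [kernel_factor]. *)
Lemma twist_op_kernel k j n : (j <= n)%N ->
  (1 - q ^+ (2 * k + 1)) * (1 - q ^+ n) * twist_op j (bailey_kernel k) n = (q ^+ n) ^+ j * kernel_factor k n j * bailey_kernel k n.
Proof.
have k0 := expf_neq0 k q0; have n0 := expf_neq0 n q0.
have E2k : q ^+ (2 * k + 1) = (q ^+ k) ^+ 2 * q by rewrite -exprM mulnC exprD.
have Enk : q ^+ (n + k + 1) = q ^+ n * q ^+ k * q by rewrite !exprD.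
have Ek1 : q ^+ k.+1 = q ^+ k * q by rewrite exprSr.
elim/ltn_ind: j => -[|[|j]] IH jn.
- rewrite /twist_op big_ord1 subn0 /kernel_factor twist_coef0 [q ^+ (k.+1 * 0 + k)]exprD !muln0 !expr0 E2k Enk Ek1.
  by field; rewrite k0 oner_neq0.
- have -> : twist_op 1 (bailey_kernel k) n = bailey_kernel k n - bailey_kernel k n.-1.
    rewrite /twist_op !big_ord_recl big_ord0 !lift0 twist_coef0 mul0n mul1n subn0 subn1 /twist_coef /=.
    by rewrite expr0 expr1; field; rewrite q0 oner_neq0.
  have Ht := casimir_kernel k n; rewrite /casimir in Ht.
  have {Ht} Ht: (1 - q ^+ n) * bailey_kernel k n.-1 = (1 + q ^+ (2 * n + 1)) * bailey_kernel k n
     - q ^+ n * (q ^+ k.+1 + (q ^+ k)^-1) * bailey_kernel k n.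
    rewrite -[in RHS]mulrA -Ht; field; exact: n0.
  rewrite -mulrA mulrBr Ht /kernel_factor E2k Enk [q ^+ (k.+1 * 1 + k)]exprD muln1 Ek1 !expr1.
  have -> : q ^+ (2 * n + 1) = (q ^+ n) ^+ 2 * q by rewrite -exprM mulnC exprD.
  by field.
have IH1 := IH j.+1 (ltnSn _) (ltnW jn).
have IH0 := IH j (leqW (ltnSn _)) (ltnW (ltnW jn)).
rewrite twist_op_rec // (twist_op_lin _ _ (casimir_kernel k)).
move: (twist_op j.+1 _ n) (twist_op j _ n) ((1 - q ^+ (2 * k + 1)) * (1 - q ^+ n)) IH1 IH0 => x1 x0 K IH1 IH0.
transitivity (q ^+ n * (q ^+ k.+1 + q ^- k) * (K * x1) - q * q ^+ n ^+ 2 * (K * x0)); first by ring.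
rewrite IH1 IH0 /kernel_factor Enk Ek1.
have -> : (k.+1 * j.+2 + k = (k.+1 * j + k) + k + k + 2)%N by lia.
have -> : (k.+1 * j.+1 + k = (k.+1 * j + k) + k + 1)%N by lia.
rewrite !exprD [(_ ^+ n) ^+ j.+1]exprSr [(_ ^+ n) ^+ j.+2]exprSr [(_ ^+ n) ^+ j.+1]exprSr [(_ ^+ k) ^+ j.+1]exprSr [(_ ^+ k) ^+ j.+2]exprSr [(_ ^+ k) ^+ j.+1]exprSr.
have H := expf_neq0 j k0.
move: ((q ^+ k) ^+ j) (q ^+ (k.+1 * j)) H => u v u0.
by field; rewrite u0 k0.
Qed.

Definition masbaum_weight m k : F := (-1) ^+ k * q ^+ (m * (k * (k + 1)) + (k * (k - 1)) %/ 2).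

Lemma masbaum_sumE m N n : (n < N)%N -> masbaum_sum q m n =
  \sum_(k < N) masbaum_weight m k * (1 - q ^+ (2 * k + 1)) * bailey_kernel k n.
Proof.
move=> nN; rewrite /masbaum_sum.
pose G k := masbaum_weight m k * (1 - q ^+ (2 * k + 1)) * bailey_kernel k n.
rewrite -[RHS]/(\sum_(k < N) G k) (eq_bigr (fun k : 'I_n.+1 => G k)); last first.
  by move=> [k /= kn] _; rewrite /G /bailey_kernel -ltnS kn.
rewrite (big_ord_widen N G) // big_mkcond; apply: eq_bigr => k _; case: ltnP => // kn.
by rewrite /G /bailey_kernel leqNgt kn mulr0.
Qed.

Lemma triangularS k : ((k.+1 * (k.+1 - 1)) %/ 2 = (k * (k - 1)) %/ 2 + k)%N.
Proof.
rewrite subn1 /= [RHS]addnC -divnMDl //; congr (_ %/ _)%N; case: k => // k; rewrite subn1 /=; lia.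
Qed.

(** The factor 1 - q^n is introduced to apply [twist_op_kernel] and can be removed
    because n > 0; the remaining sum telescopes. *)
Lemma masbaum_rec m n : (m <= n)%N -> (0 < n)%N -> twist_op m (masbaum_sum q m) n = 0.
Proof.
move=> mn n0; suff: (1 - q ^+ n) * twist_op m (masbaum_sum q m) n = 0.
  move=> /eqP; rewrite mulf_eq0 -(prednK n0) (negPf (subX_neq0 _)) /= => /eqP.
  by rewrite prednK.
have -> : twist_op m (masbaum_sum q m) n =
    \sum_(k < n.+1) masbaum_weight m k * (1 - q ^+ (2 * k + 1)) * twist_op m (bailey_kernel k) n.
  rewrite /twist_op (eq_bigr (fun i : 'I_m.+1 => \sum_(k < n.+1) masbaum_weight m k * (1 - q ^+ (2 * k + 1)) *
    (q ^- (i * m) * twist_coef (q ^+ n) q m i * bailey_kernel k (n - i)%N))); last first.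
    move=> i _; rewrite (@masbaum_sumE m n.+1) ?ltnS ?leq_subr // mulr_sumr.
    by apply: eq_bigr => k _; ring.
  by rewrite exchange_big /=; apply: eq_bigr => k _; rewrite mulr_sumr.
(* The indices k and -1-k contribute symmetrically, and the two parts of
   kernel_factor are values of one function a at k and k + 1. *)
pose a k := if (k <= n)%N then q ^+ (m * k ^ 2 + (k * (k - 1)) %/ 2) * (1 - q ^+ k)
   * (qp n / (qp (n + k) * qp (n - k))) else 0.
have E k : (k <= n)%N -> (1 - q ^+ n) * (masbaum_weight m k * (1 - q ^+ (2 * k + 1)) * twist_op m (bailey_kernel k) n) =
    (q ^+ n) ^+ m * ((-1) ^+ k * (a k + a k.+1)).
  move=> kn; have -> : (1 - q ^+ n) * (masbaum_weight m k * (1 - q ^+ (2 * k + 1)) * twist_op m (bailey_kernel k) n)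
    = masbaum_weight m k * ((1 - q ^+ (2 * k + 1)) * (1 - q ^+ n) * twist_op m (bailey_kernel k) n) by ring.
  rewrite twist_op_kernel // /kernel_factor /a /masbaum_weight kn /bailey_kernel kn triangularS.
  have -> : (m * k.+1 ^ 2 = m * k ^ 2 + k * m + k * m + m)%N by lia.
  have -> : (k.+1 * m + k = k * m + m + k)%N by lia.
  have -> : (m * (k * (k + 1)) = m * k ^ 2 + k * m)%N by lia.
  rewrite -!exprM !exprD.
  have km0 := expf_neq0 (k * m) q0; have k0 := expf_neq0 k q0.
  have p1 := qp_neq0 (n + k); have p2 := qp_neq0 (n - k).
  rewrite !addn1 qpS addnS qpS [q ^+ k.+1]exprSr [q ^+ (n + k).+1]exprSr exprD.
  have s1 := subX_neq0 (n + k); rewrite [q ^+ (n + k).+1]exprSr exprD in s1.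
  case: (ltnP k n) => [lkn|]; last first.
    move=> nk; have kn' : k = n by apply/eqP; rewrite eqn_leq kn.
    rewrite -kn' in p1 s1 *; rewrite subnn qp0; field.
    by rewrite p1 s1 k0 km0.
  have p3 := qp_neq0 (n - k.+1); have s3 := subX_neq0 (n - k.+1).
  have -> : (n - k = (n - k.+1).+1)%N by lia.
  rewrite qpS.
  have En : q ^+ (n - k.+1).+1 = q ^+ n / q ^+ k.
    apply/(canRL (mulfK k0)); rewrite -exprD; congr (_ ^+ _); lia.
  rewrite En in s3 *; field.
  rewrite km0 p1 p3 k0.
  have -> : q ^+ k - q ^+ n = q ^+ k * (1 - q ^+ n / q ^+ k) by field.
  by rewrite s1 mulf_neq0.
rewrite mulr_sumr (eq_bigr (fun k : 'I_n.+1 => (q ^+ n) ^+ m * ((-1) ^+ k * (a k + a k.+1)))); last first.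
  by move=> [k /= kn] _; rewrite E.
rewrite -mulr_sumr.
have -> N : \sum_(k < N) (-1) ^+ k * (a k + a k.+1) = a 0%N - (-1) ^+ N * a N.
  elim: N => [|N IH]; first by rewrite big_ord0 mul1r subrr.
  by rewrite big_ord_recr IH /= exprS; ring.
by rewrite /a ltnn /= subrr mulr0 mul0r mulr0 subr0 mulr0.
Qed.

Lemma masbaum_0 m : masbaum_sum q m 0 = 1.
Proof.
rewrite /masbaum_sum big_ord1 mul0n muln0 mul0n div0n expr0 /qpoch big_nat1 big_geq //.
by field; rewrite ?(subX_neq0 0) ?oner_neq0.
Qed.

(** If h vanishes beyond N, the recurrence read at N + m has only its last term left;
    its coefficient is nonzero there, so h vanishes at N as well, and by descent at
    0, where its value is 1. *)
Lemma masbaum_not_finsupp m N : (0 < m)%N ->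
  ~ (forall n, (N <= n)%N -> masbaum_sum q m n = 0).
Proof.
case: m => // m _; elim: N => [|N IH] H.
  by have /eqP := H 0%N (leqnn _); rewrite masbaum_0 (negPf (oner_neq0 _)).
apply: IH => n; rewrite leq_eqVlt => /orP[/eqP <-|]; last exact: H.
have := @masbaum_rec m.+1 (N + m.+1)%N (leq_addl _ _) (ltn_addl _ (ltn0Sn _)).
rewrite /twist_op big_ord_recr big1 /= ?add0r ?addnK => [|[i /= im] _]; last first.
  rewrite H ?mulr0 //; lia.
move=> /eqP; rewrite mulf_eq0 => /orP[|/eqP//]; rewrite mulf_eq0 invr_eq0 (negPf (expf_neq0 _ q0)) /=.
rewrite twist_coef_diag mulf_eq0 expf_eq0 oppr_eq0 (negPf q0) andbF /= => /prodf_eq0[j _].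
rewrite mulf_eq0 (negPf (expf_neq0 _ q0)) /=.
have -> : (N + m.+1 = j.+1 + (N + m - j.+1).+1)%N by case: j => j /=; lia.
by rewrite exprD -[Z in Z - _]mulr1 -mulrBr mulf_eq0 (negPf (expf_neq0 _ q0)) (negPf (subX_neq0 _)).
Qed.
End Recursion.

(** * Irreducibility of the reversed classical polynomial *)

(** With y = -G this is (1 - Q) times the polynomial of the coefficients
    [twist_coef Q 1 k] in the variable E^-1 = y / (1 - Q). *)
Fixpoint Tpol (R : comNzRingType) (G Q : R) (k : nat) : R :=
  match k with
  | 0 => 1 - Q
  | k1.+1 => match k1 with
     | 0 => G + 1 - Q
     | k2.+1 => (G + 1 + Q ^+ 2) * Tpol G Q k1 - Q ^+ 2 * Tpol G Q k2
     end
  end.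

Arguments Tpol : simpl never.

Lemma TpolSS (R : comNzRingType) (G Q : R) k :
  Tpol G Q k.+2 = (G + 1 + Q ^+ 2) * Tpol G Q k.+1 - Q ^+ 2 * Tpol G Q k.
Proof. by []. Qed.

Lemma Tpol_morph (R S : comNzRingType) (f : {rmorphism R -> S}) (G Q : R) k :
  f (Tpol G Q k) = Tpol (f G) (f Q) k.
Proof.
elim/ltn_ind: k => -[|[|k]] IH.
- by rewrite rmorphB rmorph1.
- by rewrite rmorphB rmorphD rmorph1.
by rewrite !TpolSS !(rmorphB, rmorphD, rmorph1, rmorphXn, rmorphM) !IH.
Qed.

Lemma poly_scaleI (R : idomainType) (c : R) : c != 0 -> injective (fun p : {poly R} => c *: p).
Proof.
move=> c0 p p'; rewrite -!mul_polyC => /mulfI; apply.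
by rewrite polyC_eq0.
Qed.

Section Irreducible.
Variable F : closedFieldType.

Definition Tbiv k : {poly {poly F}} := Tpol 'X 'X%:P k.

(** The substitution Q = t, G = G t^2, as a polynomial in t: its degree is the
    weight of A when G has weight 2 and Q has weight 1, and its leading coefficient
    is the top weighted part of A at Q = 1. *)
Definition weigh (A : {poly {poly F}}) : {poly {poly F}} :=
  (map_poly (map_poly polyC) A).['X^2 * 'X%:P].

Lemma weighM A B : weigh (A * B) = weigh A * weigh B.
Proof. by rewrite /weigh rmorphM hornerM. Qed.

Lemma coef_weigh A k i : (weigh A)`_k`_i = if (2 * i <= k)%N then A`_i`_(k - 2 * i) else 0.
Proof.
rewrite /weigh horner_coef size_map_inj_poly ?rmorph0 //; last first.
  by apply: map_poly_inj; apply: polyC_inj.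
rewrite coef_sum coef_sum.
have E j : ((map_poly (map_poly polyC) A)`_j * ('X^2 * 'X%:P) ^+ j)`_k`_i
  = if (i == j) && (2 * i <= k)%N then A`_i`_(k - 2 * i) else 0.
  rewrite coef_map exprMn -exprM -polyC_exp mulrA coefMC coefMXn.
  rewrite coefMXn; case: (ltngtP i j) => [//|ij|->].
    by case: ifP => _; rewrite ?coef0 // coef_map coefC subn_eq0 leqNgt ij.
  rewrite subnn; case: (ltnP k (2 * j)) => kj; first by rewrite coef0.
  by rewrite coef_map coefC.
rewrite (eq_bigr (fun j : 'I_(size A) => if (i == j) && (2 * i <= k)%N then A`_i`_(k - 2 * i) else 0)).
  case: (ltnP i (size A)) => iA.
    rewrite (bigD1 (Ordinal iA)) //= eqxx /= big1 ?addr0 // => j ji.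
    by case: eqP => // ij; rewrite -val_eqE /= ij eqxx in ji.
  rewrite big1 => [|j _]; last by rewrite gtn_eqF // (leq_trans (ltn_ord j)).
  by rewrite [A`_i]nth_default // coef0 if_same.
by move=> j _; exact: E.
Qed.

(** In T_(k+2) = (G + 1 + Q^2) T_(k+1) - Q^2 T_k the last term has too small a
    weight, so that the top parts form a geometric progression. *)
Lemma weigh_T k : size (weigh (Tbiv k.+1)) = (2 * k.+1).+1 /\
   lead_coef (weigh (Tbiv k.+1)) = 'X * ('X + 1) ^+ k.
Proof.
have ET j : weigh (Tbiv j) = Tpol ('X^2 * 'X%:P) 'X j.
  rewrite /weigh /Tbiv -[LHS]/((horner_eval ('X^2 * 'X%:P) \o map_poly (map_poly polyC)) _).
  rewrite Tpol_morph /= /horner_eval map_polyX map_polyC hornerX hornerC /=.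
  by rewrite map_polyX.
rewrite ET.
have sG c : c != 0 -> size ('X^2 * c%:P : {poly {poly F}}) = 3%N /\ lead_coef ('X^2 * c%:P : {poly {poly F}}) = c.
  move=> c0; rewrite mulrC mul_polyC size_scale // size_polyXn; split=> //.
  by rewrite lead_coefZ lead_coefXn mulr1.
have X1 : 'X + 1 != 0 :> {poly F}.
  by rewrite -size_poly_eq0 -[1]opprK -(rmorph1 polyC) -polyCN size_XsubC.
suff: (size (Tpol ('X^2 * 'X%:P) 'X k : {poly {poly F}}) <= 2 * k + 2)%N /\
  size (Tpol ('X^2 * 'X%:P) 'X k.+1 : {poly {poly F}}) = (2 * k.+1).+1 /\
   lead_coef (Tpol ('X^2 * 'X%:P) 'X k.+1 : {poly {poly F}}) = 'X * ('X + 1) ^+ k.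
  by case.
elim: k => [|k [IH0 [IH1 IH2]]].
  have [s l] := sG 'X (negbT (polyX_eq0 _)).
  have s1 : size (1 - 'X : {poly {poly F}}) = 2%N.
    by rewrite -opprB size_polyN size_XsubC.
  split; first by rewrite s1.
  rewrite -[Tpol _ _ 1]/(_ + 1 - _) -addrA size_polyDl ?s ?s1 //; split=> //.
  by rewrite lead_coefDl ?s ?s1 // l mulr1.
split; first by rewrite IH1; lia.
rewrite TpolSS.
have -> : ('X^2 * 'X%:P + 1 + 'X^2 : {poly {poly F}}) = 'X^2 * ('X + 1)%:P + 1.
  by rewrite polyCD polyC1; ring.
have [s l] := sG _ X1.
have s' : size ('X^2 * ('X + 1)%:P + 1 : {poly {poly F}}) = 3%N.
  by rewrite size_polyDl s // size_poly1.
have l' : lead_coef ('X^2 * ('X + 1)%:P + 1 : {poly {poly F}}) = 'X + 1.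
  by rewrite lead_coefDl ?l // s size_poly1.
have n0 : ('X^2 * ('X + 1)%:P + 1 : {poly {poly F}}) != 0 by rewrite -size_poly_eq0 s'.
have n1 : Tpol ('X^2 * 'X%:P) 'X k.+1 != 0 :> {poly {poly F}} by rewrite -size_poly_eq0 IH1.
have sM : size (('X^2 * ('X + 1)%:P + 1 : {poly {poly F}}) * Tpol ('X^2 * 'X%:P) 'X k.+1) = (2 * k.+2).+1.
  by rewrite size_mul // s' IH1; lia.
have lt : (size (- ('X^2 * Tpol ('X^2 * 'X%:P) 'X k : {poly {poly F}})) < (2 * k.+2).+1)%N.
  rewrite size_polyN; apply: leq_ltn_trans (size_polyMleq _ _) _; rewrite size_polyXn.
  by rewrite addSn /= ltnS (leq_trans (leq_add (leqnn 2) IH0)) //; lia.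
rewrite size_polyDl ?sM // lead_coefDl ?sM // lead_coefM l' IH2; split=> //.
by rewrite exprS; ring.
Qed.

Lemma T_at0 k : (Tbiv k)`_0 = 1 - 'X.
Proof.
rewrite -horner_coef0 /Tbiv -[LHS]/(horner_eval 0 _) Tpol_morph /= /horner_eval hornerX hornerC.
elim/ltn_ind: k => -[|[|k]] IH //; first by rewrite /Tpol add0r.
by rewrite TpolSS !IH //; ring.
Qed.

(** The factor whose top part does not vanish at G = 0 has a constant term of
    the same weight as itself.  That constant term divides 1 - Q, so its weight is
    at most 1, whereas a monomial of positive degree in G weighs at least 2. *)
Lemma T_irreducible k (A B : {poly {poly F}}) : Tbiv k.+1 = A * B -> (size A <= 1)%N \/ (size B <= 1)%N.
Proof.
wlog la : A B / (lead_coef (weigh A)).[0] != 0.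
  move=> W E; case: (eqVneq (lead_coef (weigh A)).[0] 0) => [a0|]; last by move=> h; exact: W E.
  case: (eqVneq (lead_coef (weigh B)).[0] 0) => [b0|h]; last first.
    by have [] := W B A h; [rewrite E mulrC | right | left].
  have [_] := weigh_T k; rewrite E weighM lead_coefM.
  have /factor_theorem[a ->] : root (lead_coef (weigh A)) 0 by apply/rootP.
  have /factor_theorem[b ->] : root (lead_coef (weigh B)) 0 by apply/rootP.
  rewrite polyC0 subr0 => /(congr1 (fun p : {poly F} => p`_1)).
  have -> : a * 'X * (b * 'X) = (a * b) * 'X^2 by ring.
  rewrite coefMXn /= coefXM /= -horner_coef0 horner_exp !hornerE expr1n => /eqP.
  by rewrite eq_sym oner_eq0.
(* The monomial of top weight w in A that is free of G, and then a monomial of A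
   of top degree d in G. *)
move=> E; left; set w := (size (weigh A)).-1.
have Aw : A`_0`_w != 0.
  by move: la; rewrite horner_coef0 /lead_coef coef_weigh muln0 /= subn0.
have T0 := T_at0 k.+1; rewrite E coef0M in T0.
have sA0 : (size (A`_0)%R <= 2)%N.
  have X10 : (1 - 'X : {poly F}) != 0 by rewrite -opprB oppr_eq0 polyXsubC_eq0.
  have dA : A`_0 %| 1 - 'X by rewrite -T0 dvdp_mulIl.
  have := dvdp_leq X10 dA.
  by rewrite -opprB size_polyN size_XsubC; apply.
have w1 : (w < size (A`_0)%R)%N.
  by rewrite ltnNge; apply: contraNN Aw => h; rewrite nth_default.
case: (posnP (size A)) => [->//|sA].
have lA : lead_coef A != 0 by rewrite lead_coef_eq0 -size_poly_gt0.
set d := (size A).-1; set e := (size (lead_coef A)).-1.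
have : (e + 2 * d < size (weigh A))%N.
  rewrite ltnNge; apply/negP => h.
  have /(congr1 (fun p : {poly F} => p`_d)) : (weigh A)`_(e + 2 * d) = 0 by rewrite nth_default.
  rewrite coef_weigh leq_addl addnK coef0 -/(lead_coef A) -/(lead_coef (lead_coef A)) => /eqP.
  by rewrite lead_coef_eq0 (negPf lA).
by move: sA0 w1; rewrite /w /d; lia.
Qed.

(** Gauss's lemma: at a root of g the product A B vanishes, so one of the
    factors does, and the corresponding linear factor cancels.  An algebraically
    closed field is used to have only linear factors to remove. *)
Lemma T_irreducible_content k (g : {poly F}) (A B : {poly {poly F}}) : g != 0 ->
  g *: Tbiv k.+1 = A * B -> (size A <= 1)%N \/ (size B <= 1)%N.
Proof.
have [n] := ubnP (size g); elim: n => // n IH in g A B *.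
rewrite ltnS => sg g0 E.
case: (eqVneq (size g) 1%N) => [/eqP/size_poly1P[c c0 Eg]|sg1].
  have -> : size A = size (c^-1%:P *: A) by rewrite size_scale // polyC_eq0 invr_eq0.
  apply: (@T_irreducible k); rewrite -scalerAl -E Eg scalerA -polyCM mulVf // polyC1 scale1r //.
have [x /factor_theorem [g' Eg]] := closed_rootP g sg1.
have g'0 : g' != 0 by apply: contraNneq g0 => h; rewrite Eg h mul0r.
have xx : ('X - x%:P) != 0 :> {poly F} by rewrite polyXsubC_eq0.
have sg' : (size g' < n)%N.
  by apply: leq_trans sg; rewrite Eg size_Mmonic ?monicXsubC // size_XsubC addn2.
have ev0 (C : {poly {poly F}}) : map_poly (horner_eval x) C = 0 -> exists C', C = ('X - x%:P) *: C'.
  move=> C0; exists (map_poly (fun p : {poly F} => p %/ ('X - x%:P)) C).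
  apply/polyP => i; rewrite coefZ coef_map_id0 ?div0p // mulrC divpK // dvdp_XsubCl.
  apply/rootP; have := congr1 (fun p : {poly F} => p`_i) C0.
  by rewrite coef_map coef0 /=.
have: map_poly (horner_eval x) (A * B) = 0.
  rewrite -E -mul_polyC rmorphM /= map_polyC /= /horner_eval Eg hornerM hornerXsubC subrr mulr0.
  by rewrite polyC0 mul0r.
rewrite rmorphM => /eqP; rewrite mulf_eq0 => /orP[] /eqP/ev0 [C EC].
  rewrite EC size_scale //; apply: (IH g') => //.
  by apply: (poly_scaleI xx); rewrite scalerA mulrC -Eg E EC -scalerAl.
rewrite EC size_scale //; apply: (IH g') => //.
by apply: (poly_scaleI xx); rewrite scalerA mulrC -Eg E EC -scalerAr.
Qed.
End Irreducible.

(** * Irreducibility of the classical polynomial over the rationals *)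

Section ScaledReversal.
Variables (R : idomainType) (c : R).

(** The polynomial x^d A (c / x). *)
Definition scaled_rev d (A : {poly R}) : {poly R} := \sum_(i < d.+1) (A`_i * c ^+ i) *: 'X^(d - i).

Lemma scaled_revD d A B : scaled_rev d (A + B) = scaled_rev d A + scaled_rev d B.
Proof. by rewrite /scaled_rev -big_split; apply: eq_bigr => i _; rewrite coefD mulrDl scalerDl. Qed.

Lemma scaled_rev0 d : scaled_rev d 0 = 0.
Proof. by rewrite /scaled_rev big1 // => i _; rewrite coef0 mul0r scale0r. Qed.

Lemma scaled_revZ d a A : scaled_rev d (a *: A) = a *: scaled_rev d A.
Proof. by rewrite /scaled_rev scaler_sumr; apply: eq_bigr => i _; rewrite coefZ scalerA mulrA. Qed.

Lemma scaled_revXn d k : (k <= d)%N -> scaled_rev d 'X^k = c ^+ k *: 'X^(d - k).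
Proof.
rewrite -ltnS => kd; rewrite /scaled_rev (bigD1 (Ordinal kd)) //= coefXn eqxx mul1r big1 ?addr0 // => i ik.
by rewrite -val_eqE /= in ik; rewrite coefXn (negPf ik) mul0r scale0r.
Qed.

Lemma scaled_revM d e (A B : {poly R}) : (size A <= d.+1)%N -> (size B <= e.+1)%N ->
  scaled_rev (d + e) (A * B) = scaled_rev d A * scaled_rev e B.
Proof.
move=> sA sB.
have EA : A = \sum_(i < d.+1) A`_i *: 'X^i.
  rewrite -poly_def; apply/polyP => i; rewrite coef_poly; case: ltnP => // di.
  by rewrite nth_default // (leq_trans sA).
have EB : B = \sum_(i < e.+1) B`_i *: 'X^i.
  rewrite -poly_def; apply/polyP => i; rewrite coef_poly; case: ltnP => // di.
  by rewrite nth_default // (leq_trans sB).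
rewrite {1}EA {1}EB mulr_suml (big_morph (scaled_rev (d + e)) (scaled_revD _) (scaled_rev0 _)) [scaled_rev d A]/scaled_rev mulr_suml.
apply: eq_bigr => -[i /= id] _; rewrite mulr_sumr (big_morph (scaled_rev (d + e)) (scaled_revD _) (scaled_rev0 _)).
rewrite [scaled_rev e B]/scaled_rev mulr_sumr; apply: eq_bigr => -[j /= je] _.
rewrite -scalerAl -scalerAr -exprD !scaled_revZ scaled_revXn; last by lia.
rewrite -scalerAl -scalerAr !scalerA -exprD; congr (_ *: 'X^ _); last by lia.
by rewrite exprD; ring.
Qed.

Lemma coef_scaled_rev d A k : (scaled_rev d A)`_k = if (k <= d)%N then A`_(d - k) * c ^+ (d - k) else 0.
Proof.
rewrite /scaled_rev (reindex_inj rev_ord_inj) /=.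
rewrite (eq_bigr (fun i : 'I_d.+1 => (A`_(d - i) * c ^+ (d - i)) *: 'X^i)).
  by rewrite -(poly_def d.+1 (fun i => A`_(d - i) * c ^+ (d - i))) coef_poly ltnS.
by move=> [i /= id] _; rewrite subSS subKn.
Qed.

Lemma size_scaled_rev d A : (size (scaled_rev d A) <= d.+1)%N.
Proof. by apply/leq_sizeP => j dj; rewrite coef_scaled_rev leqNgt dj. Qed.
End ScaledReversal.

(** The recurrence operator at q = 1, made monic in E. *)
Definition classical_twist (R : comNzRingType) m : {poly {poly R}} := \poly_(j < m.+1) twist_coef 'X 1 m (m - j).

(** The change of variable between E^-1 and G on coefficients: both sides satisfy
    the same recurrence. *)
Lemma T_twist_coef (F : closedFieldType) m i :
  (Tbiv F m)`_i * ('X - 1) ^+ i = (1 - 'X) * twist_coef 'X 1 m i.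
Proof.
rewrite /Tbiv; elim/ltn_ind: m i => -[|[|m]] IH i.
- rewrite /Tpol -polyC1 -polyCB coefC; case: i => [|i]; last by rewrite twist_coef_gt // mulr0 mul0r.
  by rewrite twist_coef0 expr0.
- rewrite -[Tpol _ _ 1]/('X + 1 - 'X%:P) -addrA -polyC1 -polyCB coefD coefX coefC.
  case: i => [|[|i]]; first by rewrite twist_coef0 expr0 add0r.
    by rewrite addr0 mul1r -[twist_coef _ _ _ _]/(- 1); ring.
  by rewrite twist_coef_gt // mulr0 addr0 mul0r.
rewrite TpolSS.
have -> : ('X + 1 + ('X%:P) ^+ 2 : {poly {poly F}}) = 'X + (1 + 'X ^+ 2)%:P.
  by rewrite polyCD polyC_exp polyC1 addrA.
rewrite -polyC_exp mulrDl coefB coefD coefXM !coefCM.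
case: i => [|i]; rewrite /= ?twist_coefSS.
  have := IH m.+1 (ltnSn _) 0%N; have := IH m (ltnW (ltnSn _)) 0%N.
  by rewrite !twist_coef0 expr0 !mulr1 => -> ->; ring.
have I1 := IH m.+1 (ltnSn _) i.+1; have I2 := IH m.+1 (ltnSn _) i.
have I3 := IH m (ltnW (ltnSn _)) i.+1.
rewrite !expr1n !mul1r.
rewrite !mulrDl mulNr -!mulrA I1 I3.
have -> : ((Tbiv F m.+1)`_i * ('X - 1) ^+ i.+1) = ((Tbiv F m.+1)`_i * ('X - 1) ^+ i) * ('X - 1).
  by rewrite exprSr mulrA.
by rewrite I2; ring.
Qed.

(** Degree count isolated on natural numbers: a and b are the sizes of two factors,
    x and y those of their reversals, t that of the reversed product. *)
Lemma size_factor_le1 (a b x y t m : nat) : (0 < a -> 0 < b -> x <= a.-1.+1 -> y <= b.-1.+1 ->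
  t <= (x + y).-1 -> m < t -> (a.-1 + b.-1)%N = m -> x <= 1 -> a <= 1)%N.
Proof. by lia. Qed.

(** Reversal may lower the degree of each factor, but the degree of T_m equals that
    of the classical polynomial, so it does not lower any. *)
Lemma classical_twist_irreducible_closed (F : closedFieldType) m (g : {poly F}) (A B : {poly {poly F}}) : g != 0 ->
  g *: classical_twist F m.+1 = A * B -> (size A <= 1)%N \/ (size B <= 1)%N.
Proof.
move=> g0 E.
have q10 : ('X - 1 : {poly F}) != 0 by rewrite -polyC1 polyXsubC_eq0.
have q10' : (1 - 'X : {poly F}) != 0 by rewrite -opprB oppr_eq0.
have sH : size (classical_twist F m.+1) = m.+2.
  by rewrite size_poly_eq //= subnn twist_coef0 oner_neq0.
have AB0 : A * B != 0 by rewrite -E -size_poly_eq0 size_scale // sH.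
have := AB0; rewrite mulf_eq0 negb_or => /andP[A0 B0].
have sAB : (size A + size B).-1 = m.+2 by rewrite -size_mul // -E size_scale.
have [sA sB] : (0 < size A /\ 0 < size B)%N by rewrite !size_poly_gt0.
set d := (size A).-1; set e := (size B).-1.
have dem : (d + e)%N = m.+1 by rewrite /d /e; lia.
have HH : (1 - 'X) *: scaled_rev ('X - 1) m.+1 (classical_twist F m.+1) = ('X - 1) ^+ m.+1 *: Tbiv F m.+1.
  apply/polyP => k; rewrite !coefZ coef_scaled_rev; case: leqP => km.
    rewrite coef_poly ltnS leq_subr subKn // mulrA -T_twist_coef mulrAC -!mulrA -exprD.
    by rewrite subnK // mulrC.
  rewrite mulr0; have /eqP := T_twist_coef F m.+1 k; rewrite twist_coef_gt // mulr0 mulf_eq0.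
  by rewrite expf_eq0 (negPf q10) andbF orbF => /eqP ->; rewrite mulr0.
have E2 : g * ('X - 1) ^+ m.+1 *: Tbiv F m.+1 = ((1 - 'X) *: scaled_rev ('X - 1) d A) * scaled_rev ('X - 1) e B.
  rewrite -scalerA -HH -scalerAl -scaled_revM ?/d ?/e ?prednK // -/d -/e dem -E scaled_revZ !scalerA.
  by congr (_ *: _); rewrite mulrC.
have gg : g * ('X - 1) ^+ m.+1 != 0 by rewrite mulf_neq0 ?expf_neq0.
have Tm : (m.+1 < size (Tbiv F m.+1))%N.
  rewrite ltnNge; apply/negP => h; have /eqP := T_twist_coef F m.+1 m.+1.
  rewrite nth_default // mul0r eq_sym mulf_eq0 (negPf q10') twist_coef_diag mulf_eq0 expf_eq0 oppr_eq0 oner_eq0 andbF /=.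
  by move=> /prodf_eq0 [j _]; rewrite !expr1n mul1r (negPf q10').
have sP := congr1 (fun P : {poly {poly F}} => size P) E2; rewrite /= size_scale // in sP.
have hA : (size ((1 - 'X) *: scaled_rev ('X - 1) d A) <= d.+1)%N.
  by rewrite size_scale // size_scaled_rev.
have hB := size_scaled_rev ('X - 1) e B.
have := size_polyMleq ((1 - 'X) *: scaled_rev ('X - 1) d A) (scaled_rev ('X - 1) e B); rewrite -sP => le.
have {E2} := T_irreducible_content gg E2; move: hA hB le.
move: (size ((1 - 'X) *: scaled_rev ('X - 1) d A)) (size (scaled_rev ('X - 1) e B)) => x y hA hB le.
case=> h; [left; exact: size_factor_le1 sA sB hA hB le Tm dem h | right].
by apply: (size_factor_le1 sB sA hB hA _ Tm _ h); rewrite addnC.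
Qed.

Lemma classical_twist_irreducible m (g : {poly rat}) (A B : {poly {poly rat}}) : g != 0 ->
  g *: classical_twist rat m.+1 = A * B -> (size A <= 1)%N \/ (size B <= 1)%N.
Proof.
move=> g0 E; pose f : {rmorphism {poly rat} -> {poly algC}} := map_poly (@ratr algC).
have f0 : injective f by exact: map_inj_poly (fmorph_inj _) (rmorph0 _).
have sf (P : {poly {poly rat}}) : size (map_poly f P) = size P by exact: size_map_inj_poly f0 (rmorph0 f) P.
have fg : f g != 0 by rewrite -(rmorph0 f) (inj_eq f0).
rewrite -(sf A) -(sf B); apply: (@classical_twist_irreducible_closed _ m _ _ _ fg).
rewrite -rmorphM -E -!mul_polyC rmorphM /= map_polyC /=; congr (_ * _).
apply/polyP => k; rewrite coef_map [(classical_twist rat _)`_k]coef_poly [LHS]coef_poly; case: ifP => _; last by apply: esym; exact: (rmorph0 f).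
by apply: esym; rewrite -[LHS]/(f (twist_coef _ _ _ _)) twist_coef_morph rmorph1 /f /= map_polyX.
Qed.

(** * Left ideals of annihilators in the q-Weyl algebra *)

Section Skew.
Variables (R : nzRingType) (s : {rmorphism R -> R}).

Lemma iter_rmorph0 i : iter i s 0 = 0.
Proof. by elim: i => //= i ->; rewrite rmorph0. Qed.

Lemma coef_skew_mul (f g : {poly R}) k :
  (skew_mul s f g)`_k = \sum_(i < k.+1) f`_i * iter i s g`_(k - i).
Proof.
pose N := maxn (size f) k.+1.
pose G i := if (i <= k)%N then f`_i * iter i s g`_(k - i) else 0.
rewrite /skew_mul coef_sum (eq_bigr (fun i : 'I_(size f) => G i)); last first.
  move=> i _; rewrite coefZ coefMXn /G; case: ltnP => _; first by rewrite mulr0.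
  by rewrite coef_map_id0 ?iter_rmorph0.
rewrite [RHS](eq_bigr (fun i : 'I_k.+1 => G i)); last by move=> [i /= ik] _; rewrite /G -ltnS ik.
rewrite (big_ord_widen N G) ?leq_maxl // [RHS](big_ord_widen N G) ?leq_maxr //.
rewrite big_mkcond [RHS]big_mkcond; apply: eq_bigr => i _.
rewrite /G ltnS; case: ltnP => fi; case: leqP => ik //.
by rewrite nth_default // mul0r.
Qed.

(** The operator c E^k. *)
Definition skew_monomial (c : R) k : skew_poly s := c *: 'X^k.

Lemma coef_skew_monomial_mul c k (B : skew_poly s) j :
  (skew_monomial c k * B)`_j = if (j < k)%N then 0 else c * iter k s B`_(j - k).
Proof.
rewrite skew_mulE coef_skew_mul /skew_monomial; case: ltnP => kj.
  rewrite big1 // => -[i /= ij] _; rewrite coefZ coefXn ltn_eqF ?mulr0 ?mul0r //.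
  by apply: leq_ltn_trans kj.
rewrite -ltnS in kj; rewrite (bigD1 (Ordinal kj)) //= coefZ coefXn eqxx mulr1 big1 ?addr0 //.
by move=> i; rewrite -val_eqE /= => /negPf ik; rewrite coefZ coefXn ik mulr0 mul0r.
Qed.

Lemma skew_monomial0 c : skew_monomial c 0 = c%:P.
Proof. by rewrite /skew_monomial expr0 alg_polyC. Qed.

Lemma skew_monomial0M c d : skew_monomial c 0 * skew_monomial d 0 = skew_monomial (c * d) 0.
Proof.
apply/polyP => j; rewrite coef_skew_monomial_mul /= subn0 /skew_monomial !coefZ !coefXn.
by case: eqP => _; rewrite ?mulr1 ?mulr0 ?mulr0.
Qed.
End Skew.

Lemma horner_qshift_iter k (b : {poly Qq}) n : (iter k qshift b).[q_ ^+ n] = b.[q_ ^+ (n + k)].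
Proof.
elim: k n => [|k IH] n; first by rewrite addn0.
by rewrite iterS /= horner_comp hornerZ hornerX -exprS IH addSnnS.
Qed.

Lemma iter_opE i f n : iter i opE f n = f (n + i)%N.
Proof. by elim: i n => [|i IH] n; rewrite ?addn0 //= /opE IH addSnnS. Qed.

Lemma iter_opQ j f n : iter j opQ f n = q_ ^+ n ^+ j * f n.
Proof. by elim: j => [|j IH] /=; rewrite ?mul1r // /opQ IH exprS mulrA. Qed.

Lemma act_horner N (P : Aq) f n : (size P <= N)%N ->
  act P f n = \sum_(i < N) (P`_i).[q_ ^+ n] * f (n + i)%N.
Proof.
move=> PN; pose G i := (P`_i).[q_ ^+ n] * f (n + i)%N.
rewrite -[RHS]/(\sum_(i < N) G i) /act (eq_bigr (fun i : 'I_(size P) => G i)); last first.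
  move=> i _; rewrite /G horner_coef mulr_suml; apply: eq_bigr => j _.
  by rewrite iter_opQ iter_opE mulrA.
rewrite (big_ord_widen N G) // big_mkcond; apply: eq_bigr => i _; case: ltnP => // Pi.
by rewrite /G nth_default // horner0 mul0r.
Qed.

Lemma act_add P P' f n : act (P + P') f n = act P f n + act P' f n.
Proof.
pose N := maxn (size P) (size P').
rewrite (@act_horner N P) ?leq_maxl // (@act_horner N P') ?leq_maxr //.
rewrite (@act_horner N) ?size_polyD // -big_split; apply: eq_bigr => i _.
by rewrite coefD hornerD mulrDl.
Qed.

Lemma act_opp P f n : act (- P) f n = - act P f n.
Proof.
rewrite (@act_horner (size P) (- P)) ?size_polyN // (@act_horner (size P)) // -sumrN.
by apply: eq_bigr => i _; rewrite coefN hornerN mulNr.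
Qed.

Lemma act_skew_monomial_mul c k (B : Aq) f n :
  act (skew_monomial qshift c k * B) f n = c.[q_ ^+ n] * act B f (n + k)%N.
Proof.
rewrite (@act_horner (k + size B)); last first.
  apply/leq_sizeP => j kj; rewrite coef_skew_monomial_mul; case: ifP => // _.
  by rewrite [B`_ _]nth_default ?iter_rmorph0 ?mulr0 // leq_subRL // (leq_trans _ kj) ?leq_addr.
rewrite big_split_ord /= big1 ?add0r => [|i _]; last by rewrite coef_skew_monomial_mul ltn_ord horner0 mul0r.
rewrite (act_horner _ _ (leqnn _)) mulr_sumr; apply: eq_bigr => i _.
by rewrite coef_skew_monomial_mul ltnNge leq_addr /= addKn hornerM horner_qshift_iter mulrA addnA.
Qed.

Lemma iter_qshift_eq0 k b : (iter k qshift b == 0) = (b == 0).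
Proof. by elim: k => //= k IH; rewrite qshift_eq0. Qed.

(** Euclidean division on the left of B, with the leading coefficient of B, shifted,
    as multiplier in place of its inverse.  The remainder annihilates f and is
    smaller than B, hence zero. *)
Lemma pseudo_division f (B : Aq) : annihilates f B -> B != 0 ->
  (forall P : Aq, annihilates f P -> (size P < size B)%N -> P = 0) ->
  forall P : Aq, annihilates f P ->
  exists g (A : Aq), g != 0 /\ skew_monomial qshift g 0 * P = A * B.
Proof.
move=> fB B0 Bmin P; have [n] := ubnP (size P); elim: n P => // n IH P.
rewrite ltnS => Pn fP; case: (ltnP (size P) (size B)) => PB.
  exists 1, 0; split; first exact: oner_neq0.
  by rewrite (Bmin P fP PB) mulr0 mul0r.
set k := (size P - size B)%N; set u := iter k qshift (lead_coef B).
have u0 : u != 0 by rewrite iter_qshift_eq0 lead_coef_eq0.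
have sB : (0 < size B)%N by rewrite size_poly_gt0.
pose P' : Aq := skew_monomial qshift u 0 * P - skew_monomial qshift (lead_coef P) k * B.
have fP' : annihilates f P'.
  by move=> i; rewrite act_add act_opp !act_skew_monomial_mul fP fB !mulr0 subr0.
have P'P : (size P' < size P)%N.
  rewrite -(ltn_predK (leq_trans sB PB)) ltnS; apply/leq_sizeP => j.
  rewrite leq_eqVlt => /predU1P[<-|Pj]; rewrite coefB !coef_skew_monomial_mul /= subn0.
    have -> : ((size P).-1 < k)%N = false by rewrite /k; lia.
    have -> : ((size P).-1 - k = (size B).-1)%N by rewrite /k; lia.
    by rewrite -/(lead_coef P) -/(lead_coef B) -/u mulrC subrr.
  have {}Pj : (size P <= j)%N := leq_trans (leqSpred _) Pj.
  rewrite [P`_j]nth_default //.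
  rewrite mulr0 sub0r; case: ifP => _; rewrite ?oppr0 // [B`_ _]nth_default; last first.
    by rewrite -(subKn PB) leq_sub2r.
  by rewrite iter_rmorph0 mulr0 oppr0.
have [g [A [g0 E]]] := IH P' (leq_trans P'P Pn) fP'.
exists (g * u), (A + skew_monomial qshift g 0 * skew_monomial qshift (lead_coef P) k).
split; first by rewrite mulf_neq0.
by rewrite mulrDl -E -skew_monomial0M -!mulrA -mulrDr /P' subrK.
Qed.

Lemma qshift_frac_tofrac a : qshift_frac (tofrac a) = tofrac (qshift a).
Proof.
have := frac_map_div qshift_eq0 a (oner_neq0 _).
by rewrite !rmorph1 !divr1.
Qed.

Lemma iter_qshift_frac k a : iter k qshift_frac (tofrac a) = tofrac (iter k qshift a).
Proof. by elim: k => //= k ->; rewrite qshift_frac_tofrac. Qed.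

Lemma coef_Aq_loc (P : Aq) i : (Aq_loc P)`_i = tofrac P`_i.
Proof. by rewrite /Aq_loc coef_map. Qed.

Lemma Aq_locM (P P' : Aq) : Aq_loc (P * P') = Aq_loc P * Aq_loc P'.
Proof.
apply/polyP => k; rewrite coef_Aq_loc !skew_mulE !coef_skew_mul rmorph_sum.
apply: eq_bigr => i _; rewrite rmorphM !coef_Aq_loc; congr (_ * _).
exact: esym (iter_qshift_frac _ _).
Qed.

Lemma Aq_loc_skew_monomial c : Aq_loc (skew_monomial qshift c 0) = skew_monomial qshift_frac (tofrac c) 0.
Proof. by rewrite /Aq_loc !skew_monomial0 map_polyC. Qed.

(** Inverting the multipliers of [pseudo_division] in the localization shows that
    every annihilator is a left multiple of C. *)
Theorem characteristic_of_minimal f (C1 : Aq) (C : Aloc) (v : QqQ) :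
  annihilates f C1 -> C1 != 0 ->
  (forall P : Aq, annihilates f P -> (size P < size C1)%N -> P = 0) ->
  v != 0 -> Aq_loc C1 = skew_monomial qshift_frac v 0 * C ->
  is_characteristic_polynomial f C.
Proof.
move=> fC C0 Cmin v0 E.
have C_E : C = skew_monomial qshift_frac v^-1 0 * Aq_loc C1.
  by rewrite E mulrA skew_monomial0M mulVf // skew_monomial0 polyC1 [(1%:P : Aloc) * _]mul1r.
have one (w : QqQ) (L : Aloc) : w != 0 -> L = skew_monomial qshift_frac w^-1 0 * (skew_monomial qshift_frac w 0 * L).
  by move=> w0; rewrite mulrA skew_monomial0M mulVf // skew_monomial0 polyC1 [(1%:P : Aloc) * _]mul1r.
move=> R; split.
  move=> [m [l [s [Hs ->]]]].
  have H k : exists L, s k = L * C.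
    have [P fP ->] := Hs k.
    have [g [A [g0 EA]]] := pseudo_division fC C0 Cmin fP.
    exists (skew_monomial qshift_frac (tofrac g)^-1 0 * Aq_loc A * skew_monomial qshift_frac v 0).
    have tg0 : tofrac g != 0 by rewrite tofrac_eq0.
    rewrite -!mulrA -E -Aq_locM -EA Aq_locM Aq_loc_skew_monomial; exact: one tg0.
  have {}H : exists L : Aloc, \sum_k l k * s k = L * C.
    apply: (big_ind (fun x => exists L : Aloc, x = L * C)) => [|x y [L ->] [L' ->]|k _].
    - by exists 0; rewrite mul0r.
    - by exists (L + L'); rewrite mulrDl.
    - by have [L ->] := H k; exists (l k * L); rewrite mulrA.
  exact: H.
move=> [L ->]; exists 1%N, (fun _ => L * skew_monomial qshift_frac v^-1 0), (fun _ => Aq_loc C1).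
split; first by move=> _; exists C1.
by rewrite big_ord1 C_E mulrA.
Qed.

(** * Specializing a factorization of operators at q = 1 *)

Lemma fracE (R : idomainType) (x : {fraction R}) : exists a b, b != 0 /\ x = tofrac a / tofrac b.
Proof. by exists (repr x).1, (repr x).2; split; [exact: denom_ratioP | exact: frac_repr]. Qed.

Lemma tofrac_inj (R : idomainType) : injective (@FracField.tofrac R).
Proof. by move=> x y /eqP; rewrite tofrac_eq => /eqP. Qed.

Local Notation QD := {poly {poly rat}}.

Definition at_q1 : {rmorphism QD -> {poly rat}} := map_poly (horner_eval 1).
Lemma coef_at_q1 P i : (at_q1 P)`_i = (P`_i).[1]. Proof. exact: coef_map. Qed.
Lemma at_q1C c : at_q1 c%:P = c.[1]%:P. Proof. exact: map_polyC. Qed.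

Section CommonDenominator.
Variables (R : comNzRingType) (K : fieldType) (i : {rmorphism R -> K}).
Hypothesis frac_i : forall x, exists a b, i b != 0 /\ x = i a / i b.

Lemma common_den1 (P : {poly K}) : exists d (P1 : {poly R}), i d != 0 /\ i d *: P = map_poly i P1.
Proof.
elim/poly_ind: P => [|P c [d [P1 [d0 E]]]].
  by exists 1, 0; rewrite rmorph1 oner_neq0 rmorph0 scaler0.
have [a [b [b0 ->]]] := frac_i c.
exists (d * b), (b *: P1 * 'X + (d * a)%:P); split; first by rewrite rmorphM mulf_neq0.
rewrite rmorphD (rmorphM (map_poly i)) /= map_polyX map_polyC map_polyZ -E /=.
rewrite scalerDr rmorphM scalerAl scalerA [i b * _]mulrC; congr (_ + _).
by rewrite -mul_polyC -polyCM (rmorphM i d a); congr (_%:P); field.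
Qed.

Lemma common_den (P : {poly {poly K}}) :
  exists d (P1 : {poly {poly R}}), i d != 0 /\ (i d)%:P *: P = map_poly (map_poly i) P1.
Proof.
elim/poly_ind: P => [|P c [d [P1 [d0 E]]]].
  by exists 1, 0; rewrite rmorph1 oner_neq0 rmorph0 scaler0.
have [b [c1 [b0 Ec]]] := common_den1 c.
exists (d * b), (b%:P *: P1 * 'X + (d *: c1)%:P); split; first by rewrite rmorphM mulf_neq0.
rewrite rmorphD (rmorphM (map_poly (map_poly i))) /= map_polyX map_polyC map_polyZ -E /=.
rewrite map_polyC map_polyZ /= -Ec scalerA.
rewrite scalerDr rmorphM polyCM scalerAl scalerA [(i b)%:P * _]mulrC; congr (_ + _).
by rewrite -[LHS]mul_polyC -[LHS]polyCM -mulrA !mul_polyC scalerA.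
Qed.
End CommonDenominator.

(** Every coefficient of a polynomial that vanishes at q = 1 is divisible by q - 1;
    the size of a fixed nonzero coefficient bounds the number of divisions. *)
Lemma divide_out_q1 (P : {poly QD}) : P != 0 -> exists k (P1 : {poly QD}),
  map_poly at_q1 P1 != 0 /\ P = ((('X - 1) ^+ k)%:P)%:P * P1.
Proof.
move=> P0; have [i Pi] : exists i, P`_i != 0.
  by exists (size P).-1; rewrite -/(lead_coef P) lead_coef_eq0.
have [j Pij] : exists j, P`_i`_j != 0.
  by exists (size P`_i).-1; rewrite -/(lead_coef P`_i) lead_coef_eq0.
clear P0 Pi; have [n] := ubnP (size P`_i`_j); elim: n P Pij => // n IH P Pij.
rewrite ltnS => sn; case: (eqVneq (map_poly at_q1 P) 0) => [e0|]; last first.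
  by move=> h; exists 0%N, P; rewrite expr0 mul1r.
pose P' : {poly QD} := map_poly (map_poly (fun p : {poly rat} => p %/ ('X - 1))) P.
have coefP' u v : P'`_u`_v = P`_u`_v %/ ('X - 1).
  by rewrite /P' !coef_map_id0 ?div0p // /map_poly size_poly0 poly_def big_ord0.
have dvd u v : 'X - 1 %| P`_u`_v.
  have /eqP := congr1 (fun p : QD => p`_u`_v) e0.
  by rewrite coef_map coef_at_q1 !coef0 -polyC1 dvdp_XsubCl.
have PE : P = (('X - 1)%:P)%:P * P'.
  apply/polyP => u; apply/polyP => v; rewrite !coefCM coefP' mulrC divpK //.
have Pn0 : P'`_i`_j != 0.
  by apply: contraNneq Pij => h; rewrite PE !coefCM h mulr0.
have lt : (size (P'`_i`_j)%R < n)%N.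
  apply: leq_trans sn; rewrite [in X in (_ < X)%N]PE !coefCM -polyC1.
  by rewrite mulrC size_Mmonic ?monicXsubC // size_XsubC addn2.
have [k [P1 [h E]]] := IH P' Pn0 lt.
exists k.+1, P1; split=> //.
by rewrite PE E exprS !polyCM -!mulrA.
Qed.

(** The automorphism Q |-> q Q over polynomials; it becomes the identity at q = 1. *)
Definition shiftZ : {rmorphism QD -> QD} := comp_poly ('X *: 'X).

Lemma at_q1_shift b : at_q1 (shiftZ b) = at_q1 b.
Proof.
rewrite /at_q1 /shiftZ /= map_comp_poly map_polyZ map_polyX /= /horner_eval hornerX scale1r.
by rewrite comp_polyXr.
Qed.

Lemma coef_map_at_q1 (P : {poly QD}) k : (map_poly at_q1 P)`_k = at_q1 P`_k.
Proof. exact: coef_map. Qed.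

Lemma at_q1_skew (A B : {poly QD}) :
  map_poly at_q1 (skew_mul shiftZ A B) = map_poly at_q1 A * map_poly at_q1 B.
Proof.
have ev1_iter i b : at_q1 (iter i shiftZ b) = at_q1 b by elim: i => //= i <-; rewrite at_q1_shift.
apply/polyP => k; rewrite coef_map_at_q1 coef_skew_mul coefM (rmorph_sum at_q1); apply: eq_bigr => i _.
by rewrite !coef_map_at_q1 (rmorphM at_q1) ev1_iter.
Qed.

(** The common powers of q - 1 in u and v are cancelled until u, and then necessarily
    v, is nonzero at q = 1. *)
Lemma proportional_at_q1 (u v : {poly rat}) (X Y : {poly QD}) : u != 0 ->
  map_poly at_q1 X != 0 -> map_poly at_q1 Y != 0 -> v%:P%:P * X = u%:P%:P * Y ->
  exists a b : rat, [/\ a != 0, b != 0 & a%:P *: map_poly at_q1 X = b%:P *: map_poly at_q1 Y].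
Proof.
move=> + X0 Y0; have [n] := ubnP (size u); elim: n u v => // n IH u v.
rewrite ltnS => un u0 E.
have E1 := congr1 (map_poly at_q1) E; rewrite !(rmorphM (map_poly at_q1)) /= !map_polyC /= !at_q1C !mul_polyC in E1.
case: (eqVneq u.[1] 0) => [u1|u1]; last first.
  exists v.[1], u.[1]; split=> //.
  apply: contraNneq u1 => v1; move: E1; rewrite v1 polyC0 scale0r => /esym/eqP.
  by rewrite -mul_polyC mulf_eq0 (negPf Y0) orbF !polyC_eq0.
move: E1; rewrite u1 polyC0 scale0r => /eqP.
rewrite -mul_polyC mulf_eq0 (negPf X0) orbF !polyC_eq0 => v1.
have /factor_theorem[v' Ev] : root v 1 by [].
have /factor_theorem[u' Eu] : root u 1 by apply/rootP.
have x1 : (('X - 1%:P)%:P)%:P != 0 :> {poly QD} by rewrite !polyC_eq0 polyXsubC_eq0.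
have u'0 : u' != 0 by apply: contraNneq u0 => h; rewrite Eu h mul0r.
apply: (IH u' v') => //.
  by apply: leq_trans un; rewrite Eu size_Mmonic ?monicXsubC // size_XsubC addn2.
apply: (mulfI x1); rewrite mulrA [RHS]mulrA -2!polyCM -2![in RHS]polyCM.
by rewrite [('X - _) * v']mulrC [('X - _) * u']mulrC -Eu -Ev.
Qed.

Section Clear.
Variables (K : fieldType) (i : {rmorphism {poly rat} -> K}).
Hypothesis frac_i : forall x, exists a b, i b != 0 /\ x = i a / i b.
Hypothesis inj_i : injective i.

Let i_eq0 a : (i a == 0) = (a == 0).
Proof. by rewrite -(inj_eq inj_i) rmorph0. Qed.

(** The base field K stands for Q(q) and i for its inclusion of Q[q]. *)
Definition embed : {rmorphism QD -> {poly K}} := map_poly i.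
Lemma embedC c : embed c%:P = (i c)%:P. Proof. exact: map_polyC. Qed.
Lemma embed_inj : injective embed.
Proof. by apply: map_inj_poly => //; exact: rmorph0. Qed.

Lemma primitive_at_q1 (P : {poly {poly K}}) : P != 0 -> exists (al : K) (P1 : {poly QD}),
  [/\ al != 0, P = al%:P *: map_poly embed P1 & map_poly at_q1 P1 != 0].
Proof.
move=> P0; have [d [P1 [d0 E]]] := common_den frac_i P.
have P10 : P1 != 0.
  apply: contraNneq P0 => P10; move: E; rewrite P10 rmorph0 => E.
  by rewrite -[P]scale1r -polyC1 -(mulVf d0) polyCM -scalerA E scaler0.
have [k [P2 [h E2]]] := divide_out_q1 P10.
have t0 : i (('X - 1 : {poly rat}) ^+ k) != 0.
  by rewrite i_eq0 expf_neq0 // -polyC1 polyXsubC_eq0.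
exists ((i d)^-1 * i (('X - 1) ^+ k)), P2; split=> //.
  by rewrite mulf_neq0 ?invr_eq0.
have -> : P = (i d)^-1%:P *: map_poly embed P1.
  by rewrite -E scalerA -polyCM mulVf // polyC1 scale1r.
by rewrite E2 mul_polyC map_polyZ /= embedC scalerA polyCM.
Qed.

Definition shiftK : {rmorphism {poly K} -> {poly K}} := comp_poly (i 'X *: 'X).

Lemma embed_shift b : embed (shiftZ b) = shiftK (embed b).
Proof. by rewrite /embed /shiftZ /shiftK /= map_comp_poly map_polyZ map_polyX. Qed.

Lemma coef_map_embed (P : {poly QD}) k : (map_poly embed P)`_k = embed P`_k.
Proof. exact: coef_map. Qed.

Lemma embed_skew (A B : {poly QD}) :
  map_poly embed (skew_mul shiftZ A B) = skew_mul shiftK (map_poly embed A) (map_poly embed B).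
Proof.
have iter_embed k b : embed (iter k shiftZ b) = iter k shiftK (embed b).
  by elim: k => //= k <-; rewrite embed_shift.
apply/polyP => k; rewrite coef_map_embed !coef_skew_mul (rmorph_sum embed); apply: eq_bigr => j _.
by rewrite !coef_map_embed (rmorphM embed) iter_embed.
Qed.

(** The scalars of K commute with E. *)
Lemma skewZ (a b : K) (A B : {poly {poly K}}) :
  skew_mul shiftK (a%:P *: A) (b%:P *: B) = (a * b)%:P *: skew_mul shiftK A B.
Proof.
have iterC k c : iter k shiftK c%:P = c%:P by elim: k => //= k ->; rewrite comp_polyC.
have iterM k c d : iter k shiftK (c * d) = iter k shiftK c * iter k shiftK d.
  by elim: k => //= k ->; rewrite rmorphM.
apply/polyP => k; rewrite coefZ !coef_skew_mul mulr_sumr; apply: eq_bigr => j _.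
by rewrite !coefZ iterM iterC polyCM; ring.
Qed.

(** The factors are made primitive at the place q = 1, so that none of them vanishes
    there; the scalar relating the two sides is then nonzero at q = 1 as well. *)
Theorem specialize_factorization (g : {poly K}) (A B : {poly {poly K}}) (C0 : {poly QD}) :
  g != 0 -> map_poly at_q1 C0 != 0 -> g *: map_poly embed C0 = skew_mul shiftK A B ->
  exists (g0 : {poly rat}) (A0 B0 : {poly {poly rat}}),
   [/\ g0 != 0, g0 *: map_poly at_q1 C0 = A0 * B0, (size A0 <= size A)%N & (size B0 <= size B)%N].
Proof.
move=> g0 C0n E.
have CK0 : map_poly embed C0 != 0.
  apply: contraNneq C0n => h; suff -> : C0 = 0 by rewrite rmorph0.
  by apply: (map_inj_poly embed_inj (rmorph0 _)); rewrite h rmorph0.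
have AB0 : skew_mul shiftK A B != 0.
  by rewrite -E -mul_polyC mulf_neq0 // polyC_eq0.
have An0 : A != 0.
  apply: contraNneq AB0 => ->; apply/eqP/polyP => k.
  by rewrite coef_skew_mul coef0 big1 // => j _; rewrite coef0 mul0r.
have Bn0 : B != 0.
  apply: contraNneq AB0 => ->; apply/eqP/polyP => k.
  by rewrite coef_skew_mul coef0 big1 // => j _; rewrite coef0 iter_rmorph0 mulr0.
have [al [A1 [al0 EA A10]]] := primitive_at_q1 An0.
have [be [B1 [be0 EB B10]]] := primitive_at_q1 Bn0.
have gC : g%:P != 0 by rewrite polyC_eq0.
have [ga [G1 [ga0 EG G10]]] := primitive_at_q1 gC.
have EG1 k : G1`_k.+1 = 0.
  apply: embed_inj; rewrite rmorph0; have := congr1 (fun p : {poly {poly K}} => p`_k.+1) EG.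
  rewrite coefC coefZ coef_map /= => /esym/eqP; rewrite mulf_eq0 polyC_eq0 (negPf ga0) /=.
  by move/eqP.
have {EG1 G10} [g1 G1E g10] : exists2 g1, G1 = g1%:P & at_q1 g1 != 0.
  have G1E : G1 = (G1`_0)%:P by apply/polyP => -[|k]; rewrite coefC.
  exists G1`_0 => //; apply: contraNneq G10 => h.
  by rewrite G1E map_polyC /= h.
have Eg : g = ga%:P * embed g1.
  have := congr1 (fun p : {poly {poly K}} => p`_0) EG.
  by rewrite coefC coefZ coef_map G1E coefC.
have [u [v [v0 Euv]]] := frac_i (al * be / ga).
have u0 : u != 0.
  apply/eqP => u0; have /eqP := Euv; rewrite u0 rmorph0 mul0r.
  by rewrite mulf_eq0 invr_eq0 (negPf ga0) mulf_eq0 (negPf al0) (negPf be0).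
have main : v%:P%:P * (g1 *: C0) = u%:P%:P * skew_mul shiftZ A1 B1.
  apply: (map_inj_poly embed_inj (rmorph0 _)).
  rewrite !(rmorphM (map_poly embed)) /= !map_polyC /= !embedC embed_skew map_polyZ /= !mul_polyC.
  rewrite EA EB skewZ Eg -scalerA in E.
  have -> : skew_mul shiftK (map_poly embed A1) (map_poly embed B1) =
     (ga / (al * be))%:P *: (embed g1 *: map_poly embed C0).
    have ab0 : al * be != 0 by rewrite mulf_neq0.
    have := congr1 (fun p => (al * be)^-1%:P *: p) E.
    rewrite [RHS]scalerA -[in RHS]polyCM mulVf // polyC1 scale1r => <-.
    by rewrite [LHS]scalerA -polyCM [_^-1 * _]mulrC.
  rewrite [RHS]scalerA -[in RHS]polyCM; congr (_%:P *: _).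
  have -> : i u = al * be / ga * i v by rewrite Euv; field.
  by field; rewrite al0 be0 ga0.
have ev1g : map_poly at_q1 (g1 *: C0) = at_q1 g1 *: map_poly at_q1 C0 by rewrite map_polyZ.
have sz (P : {poly QD}) : size (map_poly embed P) = size P.
  exact: size_map_inj_poly embed_inj (rmorph0 _) P.
have [||a [b [a0 b0 Eab]]] := proportional_at_q1 u0 _ _ main.
- by rewrite ev1g -mul_polyC mulf_neq0 // polyC_eq0.
- by rewrite at_q1_skew mulf_neq0.
exists (a%:P * at_q1 g1), (b%:P *: map_poly at_q1 A1), (map_poly at_q1 B1); split.
- by rewrite mulf_neq0 // polyC_eq0.
- by rewrite -scalerA -ev1g Eab at_q1_skew -scalerAl.
- by rewrite EA !size_scale ?polyC_eq0 // sz size_poly.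
- by rewrite EB !size_scale ?polyC_eq0 // sz size_poly.
Qed.
End Clear.

(** * The recurrence of the Masbaum sum is minimal *)

Lemma q_not_root_of_unity k : q_ ^+ k.+1 != 1.
Proof.
rewrite /q_ -tofracXn -tofrac1 tofrac_eq; apply/eqP => /(congr1 (fun p : {poly rat} => size p)).
by rewrite size_polyXn size_poly1.
Qed.

(** A nonzero polynomial has finitely many zeros among the powers of q.  Instead of
    bounding them, a root at a point where f does not vanish is divided out, which
    decreases the size of c. *)
Lemma poly_annihilator_finsupp (f : nat -> Qq) (c : {poly Qq}) :
  (forall N, ~ forall n, (N <= n)%N -> f n = 0) -> c != 0 ->
  ~ forall n, c.[q_ ^+ n] * f n = 0.
Proof.
move=> fN c0 H; have {H} : forall n, (0 <= n)%N -> c.[q_ ^+ n] * f n = 0 by [].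
move: 0%N => N; have [k] := ubnP (size c); elim: k c c0 N => // k IH c c0 N.
rewrite ltnS => ck H; apply: (fN N) => n Nn; apply/eqP; apply/negPn/negP => fn0.
have /eqP := H n Nn; rewrite mulf_eq0 (negPf fn0) orbF => /factor_theorem[c' Ec].
have c'0 : c' != 0 by apply: contraNneq c0 => h; rewrite Ec h mul0r.
apply: (IH c' c'0 n.+1) => [|n' nn'].
  by apply: leq_trans ck; rewrite Ec size_Mmonic ?monicXsubC // size_XsubC addn2.
have /eqP := H n' (leq_trans Nn (ltnW nn')); rewrite Ec hornerM hornerXsubC mulrAC mulf_eq0.
have -> : n' = (n + (n' - n.+1).+1)%N by lia.
by rewrite (negPf (expr_sub_neq0 q_neq0 q_not_root_of_unity _ _)) orbF => /eqP.
Qed.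

(** The coefficient of E^j in E^m [twist_op m], multiplied by q^(m^2) to clear
    negative powers of q. *)
Definition forward_coef (R : comNzRingType) m (Q q : R) j := q ^+ (j * m) * twist_coef (q ^+ m * Q) q m (m - j).

(** The recurrence operator with coefficients in Q[q][Q], where it can be
    specialized at q = 1. *)
Definition twist_rec_poly m : {poly QD} := \poly_(j < m.+1) forward_coef m 'X 'X%:P j.

Lemma forward_coef_morph (R S : comNzRingType) (f : {rmorphism R -> S}) m Q q j :
  f (forward_coef m Q q j) = forward_coef m (f Q) (f q) j.
Proof. by rewrite /forward_coef rmorphM twist_coef_morph !(rmorphM f, rmorphXn f). Qed.

Lemma at_q1_twist_rec m : map_poly at_q1 (twist_rec_poly m) = classical_twist rat m.
Proof.
apply/polyP => j; rewrite coef_map_at_q1 !coef_poly; case: ifP => _; last exact: (rmorph0 at_q1).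
have ev1X : at_q1 'X = 'X := map_polyX _.
have ev1q : at_q1 'X%:P = 1 by rewrite at_q1C hornerX.
by rewrite forward_coef_morph ev1X ev1q /forward_coef !expr1n !mul1r.
Qed.

Definition twist_rec m : Aq := map_poly (embed tofrac) (twist_rec_poly m).

Lemma horner_twist_rec m j n : (j <= m)%N -> ((twist_rec m)`_j).[q_ ^+ n] = forward_coef m (q_ ^+ n) q_ j.
Proof.
move=> jm; rewrite /twist_rec coef_map_embed coef_poly ltnS jm.
have -> : (embed tofrac (forward_coef m 'X 'X%:P j)) = forward_coef m 'X q_%:P j.
  rewrite forward_coef_morph; congr (forward_coef _ _ _ _); [exact: map_polyX | exact: map_polyC].
rewrite -[LHS]/(horner_eval (q_ ^+ n) _) forward_coef_morph /= /horner_eval hornerX hornerC.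
by [].
Qed.

Lemma size_twist_rec m : size (twist_rec m) = m.+1.
Proof.
have le : (size (twist_rec m) <= m.+1)%N.
  by apply: leq_trans (size_poly _ _) _; apply: size_poly.
apply/eqP; rewrite eqn_leq le ltnNge; apply/negP => h.
have := horner_twist_rec 0 (leqnn m); rewrite nth_default // horner0 /forward_coef subnn twist_coef0 mulr1 => /esym/eqP.
by rewrite (negPf (expf_neq0 _ q_neq0)).
Qed.

Lemma masbaum_forward (F : fieldType) (q : F) m n : q != 0 -> (forall k, q ^+ k.+1 != 1) -> (0 < m)%N ->
  \sum_(j < m.+1) forward_coef m (q ^+ n) q j * masbaum_sum q m (n + j) = 0.
Proof.
move=> q0 q1 m0; have := masbaum_rec q0 q1 (leq_addl n m) (ltn_addl n m0).
move/(congr1 (fun x => q ^+ (m * m) * x)); rewrite mulr0 => E; rewrite -[RHS]E /twist_op mulr_sumr.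
rewrite [RHS](reindex_inj rev_ord_inj) /=; apply: eq_bigr => -[j /= jm] _.
rewrite subSS /forward_coef -exprD addnC.
have -> : (n + m - (m - j) = n + j)%N by lia.
have -> : (m * m = (m - j) * m + j * m)%N by rewrite -mulnDl; congr (_ * _)%N; lia.
rewrite [q ^+ (_ + j * m)]exprD; field; exact: expf_neq0.
Qed.

Lemma annihilates_twist_rec m : (0 < m)%N -> annihilates (masbaum_sum q_ m) (twist_rec m).
Proof.
move=> m0 n; rewrite (@act_horner m.+1) ?size_twist_rec //.
rewrite -[RHS](masbaum_forward n q_neq0 q_not_root_of_unity m0); apply: eq_bigr => -[j /= jm] _.
by rewrite horner_twist_rec.
Qed.

(** The product of the leading coefficients, one of them shifted, does not vanish. *)
Lemma size_skew_mul_ge (P P' : Aq) : P != 0 -> P' != 0 -> (size P + size P' <= (size (P * P')%R).+1)%N.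
Proof.
move=> P0 P'0; have sP : (0 < size P)%N by rewrite size_poly_gt0.
have sP' : (0 < size P')%N by rewrite size_poly_gt0.
set a := (size P).-1; set b := (size P').-1.
suff : (a + b < size (P * P')%R)%N by rewrite /a /b => h; move: (size (P * P')%R) h => s; lia.
rewrite ltnNge; apply/negP => h.
have : (P * P')`_(a + b) = 0 by rewrite nth_default.
have lt : (a < (a + b).+1)%N by rewrite ltnS leq_addr.
rewrite skew_mulE coef_skew_mul (bigD1 (Ordinal lt)) //= addKn big1 ?addr0 => [/eqP|[i /= ib]].
  rewrite mulf_eq0 iter_qshift_eq0 -/(lead_coef P) -/(lead_coef P') !lead_coef_eq0.
  by rewrite (negPf P0) (negPf P'0).
rewrite -val_eqE /= => ia; case: (ltnP i a) => ia2.
  by rewrite [P'`_ _]nth_default ?iter_rmorph0 ?mulr0 // -(prednK sP') -/b; move: (a) (b) ia2 => x y; lia.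
by rewrite nth_default ?mul0r // -(prednK sP) -/a; move: (a) ia ia2 => x; lia.
Qed.

Definition no_small_annihilator (f : nat -> Qq) m :=
  forall P : Aq, annihilates f P -> (size P <= m)%N -> P = 0.

(** By induction on d, a nonzero annihilator of size d + 1 has minimal order, so it
    divides a multiple of the recurrence operator on the right; at q = 1 this contradicts irreducibility unless
    its order is 0, and then [poly_annihilator_finsupp] applies. *)
Theorem masbaum_minimal m : (0 < m)%N -> no_small_annihilator (masbaum_sum q_ m) m.
Proof.
move=> m0; have [d] : {d | d = m} by exists m.
suff H : forall d, (d <= m)%N -> no_small_annihilator (masbaum_sum q_ m) d by move=> _; exact: H.
elim=> [_ P _|{}d IH dm P fP]; first by rewrite leqn0 size_poly_eq0 => /eqP.
rewrite leq_eqVlt ltnS => /predU1P[sP|]; last exact: (IH (ltnW dm) P fP).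
have P0 : P != 0 by rewrite -size_poly_eq0 sP.
have Pmin P' : annihilates (masbaum_sum q_ m) P' -> (size P' < size P)%N -> P' = 0.
  by rewrite sP ltnS; apply: (IH (ltnW dm)).
have [g [A [g0 E]]] := pseudo_division fP P0 Pmin (annihilates_twist_rec m0).
have C0 : map_poly at_q1 (twist_rec_poly m) != 0.
  rewrite at_q1_twist_rec -size_poly_eq0 size_poly_eq // subnn twist_coef0; exact: oner_neq0.
have E' : g *: map_poly (embed tofrac) (twist_rec_poly m) = skew_mul (shiftK tofrac) A P.
  rewrite -[RHS]/(A * P : Aq) -E; apply/polyP => k.
  by rewrite coef_skew_monomial_mul /= subn0 coefZ.
have fr (x : Qq) : exists a b, tofrac b != 0 /\ x = tofrac a / tofrac b.
  by have [a [b [b0 ->]]] := fracE x; exists a, b; rewrite tofrac_eq0.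
have [g' [A0 [B0 [g'0 EAB sA sB]]]] := specialize_factorization fr (@tofrac_inj _) g0 C0 E'.
have sAP : size (A * P : Aq) = m.+1.
  by rewrite -[LHS]/(size (skew_mul (shiftK tofrac) A P)) -E' size_scale // size_twist_rec.
have A_neq0 : A != 0 by apply: contra_eq_neq sAP => ->; rewrite mul0r size_poly0.
have le := size_skew_mul_ge A_neq0 P0; rewrite sAP sP in le.
have sAB : size (A0 * B0) = m.+1.
  by rewrite -EAB size_scale // at_q1_twist_rec size_poly_eq // subnn twist_coef0 oner_neq0.
have := size_polyMleq A0 B0; rewrite sAB sP in sB * => lemul.
have [|sA1|sB1] := @classical_twist_irreducible m.-1 g' A0 B0 g'0.
- by rewrite prednK // -at_q1_twist_rec.
(* Here P would have order at least m. *)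
- by exfalso; move: (size A0) (size B0) (size A) sA1 sB sA lemul le dm => x y z; lia.
(* The factor at q = 1 coming from P is constant, so A has the full order m. *)
have d0 : d = 0%N.
  by move: (size A0) (size B0) (size A) sB1 sA lemul le dm => x y z; lia.
have [c c0 PE] : exists2 c, c != 0 & P = c%:P.
  by move: sP; rewrite d0 => /eqP/size_poly1P.
exfalso; apply: (poly_annihilator_finsupp _ c0) => [N|n].
  exact: (masbaum_not_finsupp q_neq0 q_not_root_of_unity m0).
by have := fP n; rewrite (@act_horner 1) ?sP ?d0 // big_ord1 PE coefC addn0.
Qed.

(** * The coefficients at q = 1 in binomial form *)

Section BinomialForm.
Variables (R : comNzRingType) (Q : R).

(** The coefficient of z^k in z^(l+1) / ((1 - z)^(l+1) (1 - Q^2 z)^l), as a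
    convolution. *)
Definition bin_sum l k : R := \sum_(j < k) Q ^+ (2 * j) * 'C(k.-1 - j, l)%:R * 'C(l + j - 1, j)%:R.
(** The coefficient of z^k in z^(l+1) / ((1 - z)^(l+1) (1 - Q^2 z)^(l+1)), reached
    from [bin_sum] at l + 1 by clearing one factor 1 - z. *)
Definition bin_sum2 l k : R := \sum_(j < k) Q ^+ (2 * j) * 'C(k.-1 - j, l)%:R * 'C(l + j, j)%:R.

Lemma bin_sum_diff l k : bin_sum l.+1 k.+1 - bin_sum l.+1 k = bin_sum2 l k.
Proof.
rewrite /bin_sum /bin_sum2 big_ord_recr /= subnn bin0n mulr0 mul0r addr0 -sumrB; apply: eq_bigr => -[j /= jk] _.
have -> : (k - j = (k.-1 - j).+1)%N by lia.
by rewrite binS natrD addSn subn1 /=; ring.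
Qed.

Lemma bin_sum2_diff l k : bin_sum2 l k.+1 - Q ^+ 2 * bin_sum2 l k = bin_sum l k.+1.
Proof.
rewrite /bin_sum /bin_sum2 !big_ord_recl /= mulr_sumr -addrA -sumrB !addn0 !subn0 !bin0; congr (_ + _).
apply: eq_bigr => -[j /= jk] _; rewrite /bump /= !add1n.
have -> : (k - j.+1 = k.-1 - j)%N by lia.
have -> : (l + j.+1 - 1 = l + j)%N by lia.
have -> : (2 * j.+1 = 2 + 2 * j)%N by lia.
by rewrite addnS binS natrD exprD; ring.
Qed.

(** Multiplication of the generating function by (1 - z) (1 - Q^2 z), done one factor
    at a time by the two preceding lemmas. *)
Lemma bin_sum_rec l k : bin_sum l.+1 k.+2 = (1 + Q ^+ 2) * bin_sum l.+1 k.+1 + bin_sum l k.+1 - Q ^+ 2 * bin_sum l.+1 k.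
Proof. by rewrite -(bin_sum2_diff l k) -!bin_sum_diff; ring. Qed.

Lemma bin_sum_0 k : bin_sum 0 k.+1 = 1.
Proof.
rewrite /bin_sum big_ord_recl /= !bin0 mulr1 mulr1 expr0 big1 ?addr0 // => -[j /= _] _.
by rewrite /bump /= add0n add1n subn1 /= ['C(j, j.+1)]bin_small ?mulr0.
Qed.

(** The difference of sums in the definition of b_m(Q, i), m > 0, for l = m - i. *)
Definition b_sum l m := bin_sum l m.+1 - Q * bin_sum l m.

Lemma twist_coef_binomial m l : twist_coef Q 1 m l.+1 = (-1) ^+ l.+1 * (1 - Q) ^+ l * b_sum l.+1 m.
Proof.
have bs1 i : bin_sum i.+1 1 = 0 by rewrite /bin_sum big_ord1 /= bin0n mulr0 mul0r.
have bs0 i : bin_sum i 0 = 0 by rewrite /bin_sum big_ord0.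
elim/ltn_ind: m l => -[|[|m]] IH l.
- by rewrite twist_coef_gt // /b_sum bs1 bs0 mulr0 subr0 mulr0.
- rewrite /b_sum bin_sum_rec bs1 bs0 !mulr0 add0r !subr0; case: l => [|l].
    by rewrite bin_sum_0 -[LHS]/(- 1); ring.
  by rewrite twist_coef_gt // bs1 mulr0.
rewrite twist_coefSS !expr1n !mul1r !IH // ?ltnW //.
rewrite /b_sum !bin_sum_rec; case: l => [|l].
  by rewrite twist_coef0 !bin_sum_0; ring.
by rewrite IH // /b_sum !bin_sum_rec !exprS; ring.
Qed.
End BinomialForm.

Lemma b_sumE (R : comNzRingType) (Q : R) m i : (i <= m)%N ->
  b_sum Q (m - i) m = \sum_(j < i.+1) Q ^+ (2 * j) * 'C(m - j, m - i)%:R * 'C(m - i + j - 1, j)%:R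
     - \sum_(j < i) Q ^+ (2 * j + 1) * 'C(m - j - 1, m - i)%:R * 'C(m - i + j - 1, j)%:R.
Proof.
move=> im; rewrite /b_sum /bin_sum mulr_sumr /=; congr (_ - _).
  rewrite [RHS](big_ord_widen m.+1 (fun j => Q ^+ (2 * j) * 'C(m - j, m - i)%:R * 'C(m - i + j - 1, j)%:R)) //.
  rewrite [RHS]big_mkcond; apply: eq_bigr => -[j /= jm] _; case: ltnP => // ij.
  by rewrite bin_small ?mulr0 ?mul0r //; lia.
rewrite [RHS](big_ord_widen m (fun j => Q ^+ (2 * j + 1) * 'C(m - j - 1, m - i)%:R * 'C(m - i + j - 1, j)%:R)) //.
rewrite [RHS]big_mkcond; apply: eq_bigr => -[j /= jm] _; case: ltnP => ij.
  by rewrite exprD expr1 -subn1 subnAC; ring.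
by rewrite bin_small ?mulr0 ?mul0r ?mulr0 //; lia.
Qed.

Lemma twist_coef_binomial_pos (R : comNzRingType) (Q : R) m i : (i < m)%N ->
  (- Q) ^+ (m - i) * twist_coef Q 1 m (m - i) = Q ^+ (m - i) * (1 - Q) ^+ (m - i - 1) * b_sum Q (m - i) m.
Proof.
move=> im; have -> : (m - i = (m - i).-1.+1)%N by lia.
rewrite twist_coef_binomial subn1 /=; set l := (_.-1)%N; rewrite [(- Q) ^+ _]exprNn.
have ee : ((-1) ^+ l.+1 * (-1) ^+ l.+1 = 1 :> R) by rewrite -exprMn mulrNN mulr1 expr1n.
rewrite -[RHS]mul1r -[in X in _ = X * _]ee; move: ((-1) ^+ l.+1) => e; ring.
Qed.

Lemma twist_b_posE m i : (i < m)%N -> twist_b_pos m i = (- Q_) ^+ (m - i) * twist_coef Q_ 1 m (m - i).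
Proof. by move=> im; rewrite /twist_b_pos -b_sumE ?(ltnW im) // twist_coef_binomial_pos. Qed.

(** The sums for negative p are those for positive p at the inverse of Q, with the
    order of summation reversed. *)
Lemma twist_coef_binomial_neg (F : fieldType) (Q : F) m i : Q != 0 -> (i < m)%N ->
  twist_coef Q^-1 1 m (m - i) = Q ^ (- m%:Z - i%:Z + 1) * (1 - Q) ^+ (m - i - 1)
  * (- (\sum_(j < i.+1) Q ^+ (2 * j) * 'C(m - j - 1, i - j)%:R * 'C(m - i + j, j)%:R)
     + \sum_(j < i) Q ^+ (2 * j + 1) * 'C(m - j - 2, i - j - 1)%:R * 'C(m - i + j, j)%:R).
Proof.
move=> Q0 im; have ml : (m - i = (m - i).-1.+1)%N by lia.
have Sneg : b_sum Q^-1 (m - i) m = Q ^- (2 * i) *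
   (\sum_(j < i.+1) Q ^+ (2 * j) * 'C(m - j - 1, i - j)%:R * 'C(m - i + j, j)%:R
     - \sum_(j < i) Q ^+ (2 * j + 1) * 'C(m - j - 2, i - j - 1)%:R * 'C(m - i + j, j)%:R).
  rewrite b_sumE ?(ltnW im) // mulrBr !mulr_sumr; congr (_ - _).
    rewrite (reindex_inj rev_ord_inj) /=; apply: eq_bigr => -[j /= ji] _; rewrite subSS.
    have -> : (m - (i - j) = m - i + j)%N by lia.
    have -> : (m - i + (i - j) - 1 = m - j - 1)%N by lia.
    have -> : 'C(m - i + j, m - i) = 'C(m - i + j, j).
      by rewrite -bin_sub ?leq_addr // addKn.
    have -> : (2 * i = 2 * (i - j) + 2 * j)%N by lia.
    have := expf_neq0 (2 * (i - j)) Q0; have := expf_neq0 (2 * j) Q0.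
    rewrite exprVn exprD; move: (Q ^+ _) (Q ^+ _) => a b a0 b0; field.
    by rewrite a0 b0.
  rewrite (reindex_inj rev_ord_inj) /=; apply: eq_bigr => -[j /= ji] _.
  have -> : (m - (i - j.+1) - 1 = m - i + j)%N by lia.
  have -> : (m - i + (i - j.+1) - 1 = m - j - 2)%N by lia.
  have -> : 'C(m - i + j, m - i) = 'C(m - i + j, j).
    by rewrite -bin_sub ?leq_addr // addKn.
  have -> : (i - j - 1 = i - j.+1)%N by lia.
  have -> : (2 * i = (2 * (i - j.+1) + 1) + (2 * j + 1))%N by lia.
  have := expf_neq0 (2 * (i - j.+1) + 1) Q0; have := expf_neq0 (2 * j + 1) Q0.
  rewrite exprVn [Q ^+ (_ + _ + (_ + _))]exprD; move: (Q ^+ _) (Q ^+ _) => a b a0 b0; field.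
  by rewrite ?a0 ?b0.
rewrite {1}ml twist_coef_binomial -ml Sneg.
have -> : (- m%:Z - i%:Z + 1 = - (((m - i).-1 + 2 * i)%N)%:Z) by lia.
rewrite -exprnN exprD -subn1.
have -> : (1 - Q^-1) = - (1 - Q) / Q by field.
rewrite expr_div_n [(- (1 - Q)) ^+ _]exprNn subn1 {1}ml.
set l := (_.-1)%N.
have ee : ((-1) ^+ l * (-1) ^+ l = 1 :> F) by rewrite -exprMn mulrNN mulr1 expr1n.
rewrite exprS -[RHS]mul1r -[in X in _ = X * _]ee.
have := expf_neq0 l Q0; have := expf_neq0 (2 * i) Q0.
move: ((-1) ^+ l) (Q ^+ l) (Q ^+ (2 * i)) ((1 - Q) ^+ l) => e a b c b0 a0.
field; by rewrite b0 a0.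
Qed.

Lemma twist_b_negE m i : (i < m)%N -> twist_b_neg m i = twist_coef Q_^-1 1 m (m - i).
Proof.
move=> im; rewrite twist_coef_binomial_neg //; by rewrite tofrac_eq0 polyX_eq0.
Qed.

(** * Laurent polynomials as families of functions on fields *)

Definition evN (R : comNzRingType) (N : {poly {poly int}}) (Q q : R) : R :=
  (map_poly (map_poly intr) N).[Q, q].

Section EvN.
Variables (R : comNzRingType) (Q q : R).
Lemma evND N N' : evN (N + N') Q q = evN N Q q + evN N' Q q.
Proof. by rewrite /evN (rmorphD (map_poly (map_poly intr))) !hornerD. Qed.
Lemma evNM N N' : evN (N * N') Q q = evN N Q q * evN N' Q q.
Proof. by rewrite /evN (rmorphM (map_poly (map_poly intr))) !hornerM. Qed.
Lemma evN1 : evN 1 Q q = 1.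
Proof. by rewrite /evN rmorph1 !hornerC. Qed.
Lemma evN0 : evN 0 Q q = 0.
Proof. by rewrite /evN rmorph0 !hornerC. Qed.
Lemma evNN N : evN (- N) Q q = - evN N Q q.
Proof. by rewrite /evN (rmorphN (map_poly (map_poly intr))) !hornerN. Qed.
Lemma evNX k : evN 'X^k Q q = Q ^+ k.
Proof. by rewrite /evN map_polyXn hornerXn -polyC_exp hornerC. Qed.
Lemma evNY k : evN ('X^k)%:P Q q = q ^+ k.
Proof. by rewrite /evN map_polyC /= map_polyXn hornerC hornerXn. Qed.
End EvN.

Lemma evN_morph (R S : comNzRingType) (f : {rmorphism R -> S}) N (Q q : R) :
  f (evN N Q q) = evN N (f Q) (f q).
Proof.
elim/poly_ind: N => [|N c IH]; first by rewrite !evN0 rmorph0.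
rewrite !evND !evNM rmorphD rmorphM IH -['X]expr1 !evNX !expr1; congr (_ + _).
elim/poly_ind: c => [|c a IHc]; first by rewrite !evN0 rmorph0.
rewrite polyCD polyCM !evND !evNM rmorphD rmorphM IHc -['X]expr1 !evNY !expr1; congr (_ + _).
by rewrite /evN !map_polyC /= !map_polyC /= !hornerC rmorph_int.
Qed.

(** An element of Z[Q^(+-1), q^(+-1)] given by its evaluations in all fields at
    once.  This lets one expression be read in Q(q, Q), at q = 1, and at Q = q^n,
    with a common numerator and common exponents. *)
Definition laurent_family (phi : forall F : fieldType, F -> F -> F) : Prop :=
  exists N a b, forall (F : fieldType) (Q q : F), Q != 0 -> q != 0 ->
    phi F Q q = laurent_eval N a b Q q.

Lemma laurent_evalE N a b (F : fieldType) (Q q : F) :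
  laurent_eval N a b Q q = evN N Q q * Q ^ a * q ^ b.
Proof. by []. Qed.

Lemma laurent_shift N a b k l (F : fieldType) (Q q : F) : Q != 0 -> q != 0 ->
  laurent_eval N (a + k%:Z) (b + l%:Z) Q q = laurent_eval (N * 'X^k * ('X^l)%:P) a b Q q.
Proof.
by move=> Q0 q0; rewrite !laurent_evalE !evNM evNX evNY !expfzDr // -!exprnP; ring.
Qed.

Section Closure.
Implicit Types phi psi : forall F : fieldType, F -> F -> F.

Lemma laurentE phi psi : laurent_family phi ->
  (forall (F : fieldType) (Q q : F), Q != 0 -> q != 0 -> psi F Q q = phi F Q q) -> laurent_family psi.
Proof. by move=> [N [a [b H]]] E; exists N, a, b => F Q q Q0 q0; rewrite E // H. Qed.

Lemma laurentD phi psi : laurent_family phi -> laurent_family psi ->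
  laurent_family (fun F Q q => phi F Q q + psi F Q q).
Proof.
move=> [N [a [b H]]] [N' [a' [b' H']]].
pose m c c' := (absz c + absz c')%N; pose k c c' := absz (c + (m c c')%:Z).
pose a0 : int := - (m a a')%:Z; pose b0 : int := - (m b b')%:Z.
exists (N * 'X^(k a a') * ('X^(k b b'))%:P + N' * 'X^(k a' a) * ('X^(k b' b))%:P), a0, b0.
move=> F Q q Q0 q0; rewrite H // H' // [RHS]laurent_evalE evND !mulrDl -!laurent_evalE.
rewrite -!laurent_shift //; congr (laurent_eval _ _ _ _ _ + laurent_eval _ _ _ _ _);
  rewrite /a0 /b0 /k /m; lia.
Qed.

Lemma laurentM phi psi : laurent_family phi -> laurent_family psi ->
  laurent_family (fun F Q q => phi F Q q * psi F Q q).
Proof.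
move=> [N [a [b H]]] [N' [a' [b' H']]]; exists (N * N'), (a + a'), (b + b').
by move=> F Q q Q0 q0; rewrite H // H' // !laurent_evalE evNM !expfzDr //; ring.
Qed.

Lemma laurentN phi : laurent_family phi -> laurent_family (fun F Q q => - phi F Q q).
Proof.
move=> [N [a [b H]]]; exists (- N), a, b.
by move=> F Q q Q0 q0; rewrite H // !laurent_evalE evNN !mulNr.
Qed.

Lemma laurentQ z : laurent_family (fun F Q q => Q ^ z).
Proof. by exists 1, z, 0 => F Q q Q0 q0; rewrite laurent_evalE evN1 expr0z mulr1 mul1r. Qed.

Lemma laurentq z : laurent_family (fun F Q q => q ^ z).
Proof. by exists 1, 0, z => F Q q Q0 q0; rewrite laurent_evalE evN1 expr0z !mul1r. Qed.

Lemma laurent1 : laurent_family (fun F Q q => 1).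
Proof. by apply: laurentE (laurentQ 0) _ => F Q q _ _; rewrite expr0z. Qed.

Lemma laurent0 : laurent_family (fun F Q q => 0).
Proof. by exists 0, 0, 0 => F Q q _ _; rewrite laurent_evalE evN0 !mul0r. Qed.

Lemma laurentX phi k : laurent_family phi -> laurent_family (fun F Q q => phi F Q q ^+ k).
Proof.
move=> H; elim: k => [|k IH]; first exact: laurent1.
by apply: laurentE (laurentM H IH) _ => F Q q _ _; rewrite exprS.
Qed.

Lemma laurent_twist_coef phi psi k i : laurent_family phi -> laurent_family psi ->
  laurent_family (fun F Q q => twist_coef (phi F Q q) (psi F Q q) k i).
Proof.
move=> H H'; elim/ltn_ind: k i => k IH i.
case: i => [|i]; first by apply: laurentE laurent1 _ => F Q q _ _; rewrite twist_coef0.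
case: k IH => [|[|k]] IH; first by apply: laurentE laurent0 _ => F Q q _ _; rewrite twist_coef_gt.
  case: i => [|i]; first by apply: laurentE (laurentN H') _.
  by apply: laurentE laurent0 _ => F Q q _ _; rewrite twist_coef_gt.
apply: laurentE (laurentD (laurentD
  (laurentM (laurentD (laurentX (2 * i.+1) H') (laurentM H' (laurentX 2 H))) (IH k.+1 _ i.+1))
  (laurentN (laurentM (laurentM (laurentX (i.+1 + k.+1) H') (laurentD (laurentX i H') (laurentN H))) (IH k.+1 _ i))))
  (laurentN (laurentM (laurentM (laurentX (2 * i.+1).+1 H') (laurentX 2 H)) (IH k _ i.+1)))) _ => //.
Qed.
End Closure.

(** * From a minimal recurrence to a C-polynomial *)

Local Notation QK := (tofrac 'X : QqQ).
Local Notation qK := (tofrac q_%:P : QqQ).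

Lemma QK_neq0 : QK != 0.
Proof. by rewrite tofrac_eq0 polyX_eq0. Qed.
Lemma qK_neq0 : qK != 0.
Proof. by rewrite tofrac_eq0 polyC_eq0 q_neq0. Qed.

Lemma mul_reorder (R : comNzRingType) (x y z t : R) : y * (z * (x * t)) = x * (z * t * y).
Proof. by ring. Qed.

Section Denominators.
Variables (K0 K : fieldType) (t : {rmorphism {poly K0} -> K}) (q : K0).
Hypotheses (q0 : q != 0) (tX0 : t 'X != 0).
Local Notation QK' := (t 'X).
Local Notation qK' := (t q%:P).

Lemma tq0 : qK' != 0.
Proof. by rewrite -[t _]/((t \o polyC) q) fmorph_eq0. Qed.

(** One power of Q clears the denominators both in Q(q, Q) and in the values at
    Q = q^n, which determine the action on functions. *)
Lemma family_den (phi : forall F : fieldType, F -> F -> F) : laurent_family phi ->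
  exists A (P : {poly K0}), t P = QK' ^+ A * phi K QK' qK' /\
    forall n, P.[q ^+ n] = (q ^+ n) ^+ A * phi K0 (q ^+ n) q.
Proof.
move=> [N [a [b H]]]; pose A := absz a; pose e := absz (a + A%:Z).
have eE : e%:Z = A%:Z + a by rewrite /e /A; lia.
exists A, ((q ^ b) *: (evN N 'X q%:P * 'X^e)); split; last first.
  move=> n; have Q0 := expf_neq0 n q0; rewrite H // laurent_evalE.
  rewrite hornerZ hornerM hornerXn.
  have -> : (evN N 'X q%:P).[q ^+ n] = evN N (q ^+ n) q.
    by rewrite -[LHS]/(horner_eval (q ^+ n) _) evN_morph /= /horner_eval hornerX hornerC.
  have -> : (q ^+ n) ^+ e = (q ^+ n) ^+ A * (q ^+ n) ^ a.
    by rewrite !exprnP eE expfzDr.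
  exact: mul_reorder.
rewrite H ?tX0 ?tq0 // laurent_evalE -mul_polyC !(rmorphM t) (rmorphXn t) evN_morph.
have -> : t (q ^ b)%:P = qK' ^ b by exact: (fmorphXz (t \o polyC)).
have -> : QK' ^+ e = QK' ^+ A * QK' ^ a by rewrite !exprnP eE expfzDr.
exact: mul_reorder.
Qed.

Lemma families_den m (phi : nat -> forall F : fieldType, F -> F -> F) :
  (forall i, (i < m)%N -> laurent_family (phi i)) ->
  exists A (P : nat -> {poly K0}), forall i, (i < m)%N -> t (P i) = QK' ^+ A * phi i K QK' qK' /\
    forall n, (P i).[q ^+ n] = (q ^+ n) ^+ A * phi i K0 (q ^+ n) q.
Proof.
elim: m => [|m IH] H; first by exists 0%N, (fun => 0).
have [|A [P HP]] := IH; first by move=> i im; exact: H (ltnW im).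
have [A' [P' [HP1 HP2]]] := family_den (H m (ltnSn m)).
exists (A + A')%N, (fun i => if (i < m)%N then 'X^A' * P i else 'X^A * P') => i.
rewrite ltnS leq_eqVlt => /predU1P[->|im]; rewrite ?ltnn ?im; split.
- by rewrite (rmorphM t) (rmorphXn t) HP1 mulrA -exprD.
- by move=> n; rewrite hornerM hornerXn HP2 mulrA -exprD.
- by rewrite (rmorphM t) (rmorphXn t) (HP i im).1 mulrA -exprD addnC.
- by move=> n; rewrite hornerM hornerXn (HP i im).2 mulrA -exprD addnC.
Qed.
End Denominators.

Lemma coef_monic_sum (R : nzRingType) m (c : nat -> R) j :
  ('X^m + \sum_(i < m) c i *: 'X^i)`_j = if (j < m)%N then c j else (j == m)%:R.
Proof.
rewrite coefD coefXn -(poly_def m c) coef_poly; case: (ltngtP j m) => _; rewrite ?addr0 ?add0r //.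
Qed.

Lemma lead_coef_monic_sum (R : nzRingType) m (c : nat -> R) :
  lead_coef ('X^m + \sum_(i < m) c i *: 'X^i) = 1.
Proof.
rewrite lead_coefDl ?lead_coefXn // size_polyXn -(poly_def m c) ltnS; exact: size_poly.
Qed.

Lemma laurent_specializes psi : laurent_family psi -> specializes_at_q1 (psi QqQ QK qK) (psi QQ Q_ 1).
Proof.
have Q0 : Q_ != 0 by rewrite tofrac_eq0 polyX_eq0.
move=> [N [a [b HN]]]; exists N, a, b.
split; [exact: HN QK_neq0 qK_neq0 | exact: HN Q0 (oner_neq0 _)].
Qed.

(** Multiplication by a power of Q turns the monic operator into an annihilator in
    the q-Weyl algebra, and [characteristic_of_minimal] applies to it. *)
Theorem is_C_from_family f m (phi : nat -> forall F : fieldType, F -> F -> F) :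
  (forall i, (i < m)%N -> laurent_family (phi i)) ->
  (forall n, f (n + m)%N + \sum_(i < m) phi i Qq (q_ ^+ n) q_ * f (n + i)%N = 0) ->
  no_small_annihilator f m ->
  is_C_polynomial f ('X^m + \sum_(i < m) phi i QQ Q_ 1 *: 'X^i).
Proof.
move=> H rec fmin; have [A [P HP]] := families_den (t := tofrac) q_neq0 QK_neq0 H.
pose C : {poly QqQ} := 'X^m + \sum_(i < m) phi i QqQ QK qK *: 'X^i.
pose C1 : Aq := \poly_(i < m.+1) (if i == m then 'X^A else P i).
have sC1 : size C1 = m.+1 by rewrite size_poly_eq // eqxx -size_poly_eq0 size_polyXn.
have cC : forall j, C`_j = if (j < m)%N then phi j QqQ QK qK else (j == m)%:R.
  move=> j; exact: (coef_monic_sum m (fun i => phi i QqQ QK qK)).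
exists C; split.
- apply: (@characteristic_of_minimal f C1 C (QK ^+ A)).
  + move=> n; rewrite (@act_horner m.+1) ?sC1 // big_ord_recr /= coef_poly ltnSn eqxx hornerXn.
    rewrite (eq_bigr (fun i : 'I_m => (q_ ^+ n) ^+ A * (phi i Qq (q_ ^+ n) q_ * f (n + i)%N))).
      by rewrite -mulr_sumr -mulrDr addrC rec mulr0.
    move=> [i /= im] _; rewrite coef_poly ltnS (ltnW im) (ltn_eqF im) (HP i im).2.
    by rewrite mulrA.
  + by rewrite -size_poly_eq0 sC1.
  + by move=> P'; rewrite sC1 ltnS; exact: fmin.
  + by rewrite expf_neq0 // QK_neq0.
  apply/polyP => j; rewrite coef_Aq_loc coef_skew_monomial_mul /= subn0 coef_poly ltnS cC.
  case: (ltngtP j m) => jm; [by rewrite (HP j jm).1 | by rewrite tofrac0 mulr0 | by rewrite ?jm ?eqxx tofracXn mulr1].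
- exact: (lead_coef_monic_sum m (fun i => phi i QqQ QK qK)).
move=> j; rewrite cC (coef_monic_sum m (fun i => phi i QQ Q_ 1)).
case: (ltngtP j m) => jm; [exact: laurent_specializes (H j jm) | exact: (laurent_specializes laurent0) | exact: (laurent_specializes laurent1)].
Qed.

(** * The cyclotomic functions of twist knots *)

Definition half_n_n3 n := ((n * (n + 3)) %/ 2)%N.

Lemma even_double a : ~~ odd a -> (2 * (a %/ 2) = a)%N.
Proof. by move=> e; rewrite mulnC divnK // dvdn2. Qed.

Lemma half_n_n3_double n : (2 * half_n_n3 n = n * (n + 3))%N.
Proof. by apply: even_double; rewrite oddM oddD; case: (odd n). Qed.

Lemma tri_double k : (2 * ((k * (k - 1)) %/ 2) = k * (k - 1))%N.
Proof. by apply: even_double; rewrite oddM; case: k => // k; rewrite subn1 /=; case: odd. Qed.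

Lemma tri'_double k : (2 * ((k * (k + 1)) %/ 2) = k * (k + 1))%N.
Proof. by apply: even_double; rewrite oddM oddD; case: odd. Qed.

Section CyclotomicSum.
Variables (F : fieldType) (q : F).
Hypothesis q0 : q != 0.
Hypothesis q1 : forall k, q ^+ k.+1 != 1.

(** [twist_cyclotomic] is the instance at the generator of Q(q); the identities below
    hold over any field. *)
Definition cyclotomic_sum (p : int) (n : nat) : F :=
  \sum_(k < n.+1)
    q ^ (((n * (n + 3)) %/ 2)%N%:Z + p * (k * (k + 1))%N%:Z
          + ((k * (k - 1)) %/ 2)%N%:Z)
    * (-1) ^+ (n + k + 1)
    * (((q ^+ (2 * k + 1) - 1) * qpoch q n)
       / (qpoch q (n + k + 1) * qpoch q (n - k))).

Lemma cyclotomic_sum_pos m n : cyclotomic_sum m%:Z n = (-1) ^+ n * q ^+ half_n_n3 n * masbaum_sum q m n.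
Proof.
rewrite /cyclotomic_sum /masbaum_sum mulr_sumr; apply: eq_bigr => k _.
rewrite -/(half_n_n3 n) -PoszM -!PoszD -exprnP !exprD expr1.
move: (q ^+ half_n_n3 n) (q ^+ (m * (k * (k + 1)))) (q ^+ (_ %/ 2)) (qpoch q n) => a b c d.
move: (q ^+ (2 * k)) ((-1) ^+ n) ((-1) ^+ k) ((_ * _)^-1) => x y z t.
by ring.
Qed.

Lemma qpoch_inv a : qpoch q^-1 a = (-1) ^+ a * q ^- ((a * (a + 1)) %/ 2) * qpoch q a.
Proof.
elim: a => [|a IH]; first by rewrite !qp0 mul0n div0n expr0 invr1 !mul1r.
have -> : ((a.+1 * (a.+1 + 1)) %/ 2 = (a * (a + 1)) %/ 2 + a.+1)%N.
  by have := tri'_double a; have := tri'_double a.+1; lia.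
rewrite !qpS IH exprVn exprD [(-1) ^+ a.+1]exprS.
have := expf_neq0 ((a * (a + 1)) %/ 2) q0; have := expf_neq0 a.+1 q0.
move: (q ^+ a.+1) (q ^+ _) ((-1) ^+ a) (qpoch _ _) => x y z t x0 y0.
by field; rewrite x0 y0.
Qed.

(** The balance of the powers of q when q is inverted in a term of Masbaum's
    sum, with d = n - k. *)
Lemma inversion_exponent k d : ((half_n_n3 (k + d) + (k * (k - 1)) %/ 2) + (((k + d) * (k + d + 1)) %/ 2 + ((k * (k - 1)) %/ 2 + (2 * k + 1))) =
  ((k + d + k + 1) * (k + d + k + 1 + 1)) %/ 2 + (d * (d + 1)) %/ 2)%N.
Proof.
have := half_n_n3_double (k + d); have := tri'_double (k + d); have := tri_double k.
have := tri'_double (k + d + k + 1); have := tri'_double d.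
move: (half_n_n3 _) (((k + d) * _) %/ 2)%N ((k * _) %/ 2)%N ((_ * (_ + 1 + 1)) %/ 2)%N ((d * _) %/ 2)%N => a b c e f.
case: k => [|k]; first by nia.
by rewrite subn1 /=; nia.
Qed.

(** Each q-factorial is multiplied by a sign and a power of q under inversion of q;
    together they supply exactly the prefactor (-1)^n q^(n(n+3)/2). *)
Lemma cyclotomic_sum_neg m n : cyclotomic_sum (- m%:Z) n = masbaum_sum q^-1 m n.
Proof.
rewrite /cyclotomic_sum /masbaum_sum; apply: eq_bigr => -[k /= kn] _.
have {kn} [d ->] : exists d, n = (k + d)%N by exists (n - k)%N; rewrite subnKC.
rewrite addKn -/(half_n_n3 (k + d)) !qpoch_inv.
have E := congr1 (fun a => q ^+ a) (inversion_exponent k d).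
rewrite mulNr -PoszM addrAC -PoszD expfzDr // -exprnN -exprnP.
set s := (half_n_n3 _ + _)%N in E *.
rewrite exprD in E; rewrite [in RHS]exprD in E.
rewrite !exprVn [q ^+ (m * _ + _)]exprD.
have P1 := qp_neq0 q1 (k + d); have P2 := qp_neq0 q1 (k + d + k + 1).
have P3 := qp_neq0 q1 d.
have ss (a : nat) : (-1) ^+ a * (-1) ^+ a = 1 :> F.
  by rewrite -exprMn mulrNN mulr1 expr1n.
have s1 : (-1) ^+ (k + d + k + 1) = - (-1) ^+ d :> F.
  have -> : (k + d + k + 1 = (k + k + d).+1)%N by lia.
  by rewrite exprS !exprD ss mul1r mulN1r.
have s0 (a : nat) : (-1) ^+ a != 0 :> F by rewrite expf_neq0 // oppr_eq0 oner_neq0.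
rewrite s1 [(-1) ^+ (k + d)]exprD.
rewrite [q ^+ (_ + (_ + (2 * k + 1)))]exprD [q ^+ (_ + (2 * k + 1))]exprD in E.
have {s1} Es := ss k; have Ed := ss d.
have n1 := expf_neq0 (m * (k * (k + 1))) q0.
have n2 := expf_neq0 ((k * (k - 1)) %/ 2) q0.
have n3 := expf_neq0 (((k + d) * (k + d + 1)) %/ 2) q0.
have n4 := expf_neq0 (((k + d + k + 1) * (k + d + k + 1 + 1)) %/ 2) q0.
have n5 := expf_neq0 ((d * (d + 1)) %/ 2) q0.
have n6 := expf_neq0 (2 * k + 1) q0.
have Eq : q ^+ s = q ^+ (((k + d + k + 1) * (k + d + k + 1 + 1)) %/ 2) * q ^+ ((d * (d + 1)) %/ 2)
   / (q ^+ (((k + d) * (k + d + 1)) %/ 2) * (q ^+ ((k * (k - 1)) %/ 2) * q ^+ (2 * k + 1))).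
  by apply/(canRL (mulfK _)); rewrite ?mulf_neq0.
rewrite Eq.
move: (q ^+ (((k + d + k + 1) * _) %/ 2)) (q ^+ ((d * (d + 1)) %/ 2)) (q ^+ (((k + d) * _) %/ 2))
  (q ^+ ((k * (k - 1)) %/ 2)) (q ^+ (2 * k + 1)) (q ^+ (m * _)) n4 n5 n3 n2 n6 n1 => a b c e f g a0 b0 c0 e0 f0 g0.
move: (qpoch q (k + d)) (qpoch q (k + d + k + 1)) (qpoch q d) P1 P2 P3 => x y z x0 y0 z0.
move: ((-1) ^+ k) ((-1) ^+ d) (s0 k) (s0 d) Es Ed => u v u0 v0 Es Ed.
transitivity ((u * u) / (v * v) * (a * b / (c * (e * f)) / g * - v * ((f - 1) * x / (y * z)))).
  by rewrite Es Ed divr1 mul1r.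
by field; rewrite b0 a0 z0 v0 y0 oppr_eq0 v0 c0 f0 e0 g0.
Qed.

End CyclotomicSum.

(** Multiplying f by a nonvanishing factor whose shifts differ by polynomials in q^n
    only rescales the coefficients of its annihilators. *)
Lemma gauge_minimal (f h : nat -> Qq) m (u : nat -> Qq) (w : nat -> {poly Qq}) :
  (forall n, u n != 0) -> (forall i, w i != 0) ->
  (forall n i, f (n + i)%N = u n * (w i).[q_ ^+ n] * h (n + i)%N) ->
  no_small_annihilator h m -> no_small_annihilator f m.
Proof.
move=> u0 w0 E hm P fP Pm.
pose P' : Aq := \poly_(i < size P) (P`_i * w i).
have P'0 : P' = 0.
  apply: hm; last by apply: leq_trans Pm; exact: size_poly.
  move=> n; apply: (mulfI (u0 n)); rewrite mulr0 -(fP n).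
  rewrite (@act_horner (size P) P') ?size_poly // (@act_horner (size P)) // mulr_sumr.
  apply: eq_bigr => i _; rewrite coef_poly ltn_ord E hornerM mulrCA -!mulrA; congr (_ * _).
  by rewrite mulrCA.
apply/polyP => i; rewrite coef0; case: (ltnP i (size P)) => iP; last by rewrite nth_default.
have := congr1 (fun p : Aq => p`_i) P'0; rewrite coef_poly iP coef0 => /eqP.
by rewrite mulf_eq0 (negPf (w0 i)) orbF => /eqP.
Qed.

Section FractionLift.
Variables (R : idomainType) (F : fieldType) (s : {rmorphism R -> F}).
Hypothesis s_eq0 : forall a, (s a == 0) = (a == 0).

Definition frac_lift (x : {fraction R}) : F := s (repr x).1 / s (repr x).2.

Lemma frac_lift_div a b : b != 0 -> frac_lift (tofrac a / tofrac b) = s a / s b.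
Proof.
move=> b0; rewrite /frac_lift; set x := tofrac a / tofrac b.
have /eqP := frac_repr x.
have d0 : (repr x).2 != 0 by exact: denom_ratioP.
rewrite eqr_div ?tofrac_eq0 // -!tofracM tofrac_eq => /eqP e.
by apply/eqP; rewrite eqr_div ?s_eq0 // -!rmorphM -e mulrC.
Qed.

Lemma frac_lift_tofrac a : frac_lift (tofrac a) = s a.
Proof. by rewrite -[tofrac a]divr1 -tofrac1 frac_lift_div ?oner_neq0 // rmorph1 divr1. Qed.

Lemma frac_lift_zmod : zmod_morphism frac_lift.
Proof.
move=> x y; have [a [b [b0 ->]]] := fracE x; have [c [d [d0 ->]]] := fracE y.
rewrite -mulNr addf_div ?tofrac_eq0 // mulNr -!tofracM -tofracB.
rewrite !frac_lift_div ?mulf_neq0 // -[in RHS]mulNr [in RHS]addf_div ?s_eq0 //.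
by rewrite mulNr rmorphB !rmorphM.
Qed.

Lemma frac_lift_monoid : monoid_morphism frac_lift.
Proof.
split=> [|x y]; first by rewrite -tofrac1 frac_lift_tofrac rmorph1.
have [a [b [b0 ->]]] := fracE x; have [c [d [d0 ->]]] := fracE y.
by rewrite mulf_div -!tofracM !frac_lift_div ?mulf_neq0 // !rmorphM mulf_div.
Qed.
End FractionLift.

Lemma horner_rev (F : fieldType) N (p : {poly F}) (x : F) : x != 0 -> (size p <= N.+1)%N ->
  (scaled_rev 1 N p).[x] = x ^+ N * p.[x^-1].
Proof.
move=> x0 pN; rewrite (horner_coef_wide _ pN) /scaled_rev horner_sum mulr_sumr; apply: eq_bigr => -[i /= iN] _.
rewrite expr1n mulr1 hornerZ hornerXn mulrCA; congr (_ * _).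
rewrite exprVn; apply/(canRL (mulfK _)); first by rewrite expf_neq0.
by rewrite -exprD subnK.
Qed.

Lemma rev_eq0 (F : idomainType) N (p : {poly F}) : (size p <= N.+1)%N -> scaled_rev 1 N p = 0 -> p = 0.
Proof.
move=> pN h; apply/polyP => i; rewrite coef0; case: (ltnP i N.+1) => iN; last first.
  by rewrite nth_default // (leq_trans pN).
have := congr1 (fun r : {poly F} => r`_(N - i)) h.
by rewrite coef_scaled_rev leq_subr subKn // expr1n mulr1 coef0.
Qed.

Section EvalInverse.
Variables (R : idomainType) (F : fieldType) (t : {rmorphism {poly R} -> F}).
Hypothesis t_inj : injective t.

Definition eval_inv : {rmorphism {poly R} -> F} := horner_eval (t 'X)^-1 \o map_poly (t \o polyC).

Lemma eval_invX : eval_inv 'X = (t 'X)^-1.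
Proof. by rewrite /eval_inv /= map_polyX /horner_eval hornerX. Qed.

Lemma eval_inv_eq0 p : (eval_inv p == 0) = (p == 0).
Proof.
have tX0 : t 'X != 0 by rewrite -(rmorph0 t) (inj_eq t_inj) polyX_eq0.
apply/eqP/eqP => [|->]; last exact: rmorph0.
rewrite /eval_inv /= /horner_eval => e0.
have tE r : (map_poly (t \o polyC) r).[t 'X] = t r.
  by rewrite map_poly_comp horner_map -[_.['X]]/(r \Po 'X) comp_polyXr.
apply: (@rev_eq0 _ (size p)) => //; apply: t_inj; rewrite rmorph0 -tE.
have -> : map_poly (t \o polyC) (scaled_rev 1 (size p) p) = scaled_rev 1 (size p) (map_poly (t \o polyC) p).
  apply/polyP => i; rewrite coef_map !coef_scaled_rev; case: ifP => _; last by rewrite /= polyC0 rmorph0.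
  by rewrite !expr1n !mulr1 coef_map.
by rewrite horner_rev ?e0 ?mulr0 // (leq_trans (size_poly _ _)).
Qed.
End EvalInverse.

Definition bar_poly := eval_inv (tofrac : {rmorphism {poly rat} -> Qq}).

Lemma bar_poly_eq0 a : (bar_poly a == 0) = (a == 0).
Proof. exact: (eval_inv_eq0 (@tofrac_inj _)). Qed.

(** The automorphism q |-> q^-1 of Q(q). *)
Definition bar : Qq -> Qq := frac_lift bar_poly.

HB.instance Definition _ := GRing.isZmodMorphism.Build Qq Qq bar (frac_lift_zmod bar_poly_eq0).
HB.instance Definition _ := GRing.isMonoidMorphism.Build Qq Qq bar (frac_lift_monoid bar_poly_eq0).

Lemma bar_q : bar q_ = q_^-1.
Proof. by rewrite /bar frac_lift_tofrac; [exact: eval_invX | exact: bar_poly_eq0]. Qed.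

Lemma masbaum_morph (F F' : fieldType) (f : {rmorphism F -> F'}) (q : F) m n :
  f (masbaum_sum q m n) = masbaum_sum (f q) m n.
Proof.
have fp a : f (qpoch q a) = qpoch (f q) a.
  rewrite /qpoch rmorph_prod; apply: eq_bigr => j _.
  by rewrite rmorphB rmorph1 rmorphXn.
rewrite /masbaum_sum rmorph_sum; apply: eq_bigr => k _.
by rewrite !(rmorphM f) fmorphV (rmorphM f) !fp rmorphB rmorph1 !(rmorphXn f) (rmorphN f) rmorph1.
Qed.

Section Inversion.
Variables (K : fieldType) (q : K) (b : {rmorphism K -> K}).
Hypotheses (q0 : q != 0) (bq : b q = q^-1).

(** Inverting q also inverts Q = q^n; reversal of the coefficients makes them
    polynomials in Q again. *)
Lemma bar_relation (f h : nat -> K) N M (P : nat -> {poly K}) n :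
  (forall n, b (f n) = h n) -> (forall i, (i < M)%N -> (size (P i) <= N.+1)%N) ->
  \sum_(i < M) (P i).[q ^+ n] * f (n + i)%N = 0 ->
  \sum_(i < M) (scaled_rev 1 N (map_poly b (P i))).[q ^+ n] * h (n + i)%N = 0.
Proof.
move=> bf PN /(congr1 b); rewrite rmorph0 rmorph_sum /= => E.
transitivity (q ^+ n ^+ N * \sum_(i < M) b ((P i).[q ^+ n] * f (n + i)%N)); last by rewrite E mulr0.
rewrite mulr_sumr; apply: eq_bigr => i _.
have qn0 := expf_neq0 n q0.
rewrite horner_rev ?size_map_poly ?PN // rmorphM bf mulrA; congr (_ * _ * _).
have -> : (q ^+ n)^-1 = b (q ^+ n) by rewrite rmorphXn bq exprVn.
by rewrite horner_map.
Qed.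
End Inversion.

Lemma bar_minimal (f h : nat -> Qq) m : (forall n, bar (f n) = h n) ->
  no_small_annihilator h m -> no_small_annihilator f m.
Proof.
move=> bf hm P fP Pm.
pose N := (\max_(i < size P) size (P`_i)%R)%N.
have PN i : (i < size P)%N -> (size (P`_i)%R <= N.+1)%N.
  by move=> iP; apply: leqW; exact: (leq_bigmax (Ordinal iP)).
pose P' : Aq := \poly_(i < size P) scaled_rev 1 N (map_poly bar P`_i).
have P'0 : P' = 0.
  apply: hm; last by apply: leq_trans Pm; exact: size_poly.
  move=> n; rewrite (@act_horner (size P)) ?size_poly //.
  rewrite -[RHS](@bar_relation _ q_ bar q_neq0 bar_q f h N (size P) (fun i => P`_i) n bf PN).
    by apply: eq_bigr => i _; rewrite coef_poly ltn_ord.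
  by rewrite -(act_horner _ _ (leqnn _)) fP.
apply/polyP => i; rewrite coef0; case: (ltnP i (size P)) => iP; last by rewrite nth_default.
have := congr1 (fun p : Aq => p`_i) P'0; rewrite coef_poly iP coef0 => /rev_eq0 H.
have /eqP : map_poly bar P`_i = 0 by apply: H; rewrite size_map_poly PN.
by rewrite map_poly_eq0 => /eqP.
Qed.

Lemma half_n_n3_add n j : (half_n_n3 (n + j) = half_n_n3 n + half_n_n3 j + n * j)%N.
Proof. by have := half_n_n3_double n; have := half_n_n3_double j; have := half_n_n3_double (n + j); nia. Qed.

Lemma half_n_n3_le j m : (j <= m)%N -> (half_n_n3 j <= half_n_n3 m)%N.
Proof. by move=> jm; rewrite -(subnK jm) addnC half_n_n3_add -addnA leq_addr. Qed.

Lemma twist_cyclotomicE p n : twist_cyclotomic p n = cyclotomic_sum q_ p n.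
Proof. by []. Qed.

Lemma laurent_forward_coef phi psi m j : laurent_family phi -> laurent_family psi ->
  laurent_family (fun F Q q => forward_coef m (phi F Q q) (psi F Q q) j).
Proof.
move=> H H'; apply: laurentM (laurentX _ H') (laurent_twist_coef _ _ _ H').
exact: laurentM (laurentX _ H') H.
Qed.

Lemma laurent_Q : laurent_family (fun F Q q => Q).
Proof. by apply: laurentE (laurentQ 1) _. Qed.

Lemma laurent_q : laurent_family (fun F Q q => q).
Proof. by apply: laurentE (laurentq 1) _. Qed.

Lemma laurent_Qinv : laurent_family (fun F Q q => Q^-1).
Proof. by apply: laurentE (laurentQ (- 1%:Z)) _ => F Q q _ _; rewrite exprN1. Qed.

Lemma laurent_qinv : laurent_family (fun F Q q => q^-1).
Proof. by apply: laurentE (laurentq (- 1%:Z)) _ => F Q q _ _; rewrite exprN1. Qed.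

(** The coefficients of the monic recurrence for p = m: those of h_m, twisted by the
    ratio of the prefactors (-1)^n q^(n(n+3)/2) at n + m and n + j. *)
Definition monic_coef_pos m j (F : fieldType) (Q q : F) : F :=
  (- Q) ^+ (m - j) * q ^+ (half_n_n3 m - half_n_n3 j) * q^-1 ^+ (m * m) * forward_coef m Q q j.

(** The coefficients of the monic recurrence for p = -m: those of h_m with Q and q
    inverted. *)
Definition monic_coef_neg m j (F : fieldType) (Q q : F) : F :=
  q ^+ (m * m) * forward_coef m Q^-1 q^-1 j.

Lemma laurent_monic_coef_pos m j : laurent_family (monic_coef_pos m j).
Proof.
apply: laurentM (laurentM (laurentM _ _) _) _.
- exact: laurentX (laurentN laurent_Q).
- exact: laurentX laurent_q.
- exact: laurentX laurent_qinv.
- exact: laurent_forward_coef laurent_Q laurent_q.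
Qed.

Lemma laurent_monic_coef_neg m j : laurent_family (monic_coef_neg m j).
Proof.
by apply: laurentM (laurentX _ laurent_q) (laurent_forward_coef _ _ laurent_Qinv laurent_qinv).
Qed.

Section FinalRecurrences.
Variables (F : fieldType) (q : F).
Hypothesis q0 : q != 0.
Hypothesis q1 : forall k, q ^+ k.+1 != 1.

Lemma cyclotomic_sum_pos_rec m n : (0 < m)%N ->
  cyclotomic_sum q m%:Z (n + m)%N + \sum_(j < m) monic_coef_pos m j (q ^+ n) q * cyclotomic_sum q m%:Z (n + j)%N = 0.
Proof.
move=> m0; have := masbaum_forward n q0 q1 m0.
move/(congr1 (fun x => (-1) ^+ (n + m) * q ^+ half_n_n3 (n + m) * q^-1 ^+ (m * m) * x)); rewrite mulr0.
rewrite big_ord_recr /= mulrDr mulr_sumr addrC => E; rewrite -[RHS]E; congr (_ + _).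
  rewrite cyclotomic_sum_pos /forward_coef subnn twist_coef0 mulr1 exprVn.
  have := expf_neq0 (m * m) q0; move: (q ^+ (m * m)) (q ^+ _) (_ ^+ (n + m)) => x y z x0.
  by field.
apply: eq_bigr => -[j /= jm] _; rewrite cyclotomic_sum_pos /monic_coef_pos mulrA; move: (forward_coef _ _ _ _) (masbaum_sum _ _ _) => r h.
have -> : q ^+ half_n_n3 (n + m) = q ^+ half_n_n3 (n + j) * (q ^+ n) ^+ (m - j) * q ^+ (half_n_n3 m - half_n_n3 j).
  rewrite -exprM -!exprD !half_n_n3_add; congr (_ ^+ _); have := half_n_n3_le (ltnW jm).
  have -> : (n * m = n * (m - j) + n * j)%N by rewrite -mulnDr subnK // ltnW.
  by lia.
have -> : (-1) ^+ (n + m) = (-1) ^+ (m - j) * (-1) ^+ (n + j) :> F.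
  by rewrite -exprD; congr (_ ^+ _); lia.
rewrite [(- (q ^+ n)) ^+ (m - j)]exprNn.
move: ((-1) ^+ (m - j)) ((-1) ^+ (n + j)) ((q ^+ n) ^+ _) (q ^+ half_n_n3 _) (q ^+ (_ - _)) (_ ^+ (m * m)) => a b c d e f.
by ring.
Qed.

Lemma cyclotomic_sum_neg_rec m n : (0 < m)%N ->
  cyclotomic_sum q (- m%:Z) (n + m)%N + \sum_(j < m) monic_coef_neg m j (q ^+ n) q * cyclotomic_sum q (- m%:Z) (n + j)%N = 0.
Proof.
move=> m0; have q0' : q^-1 != 0 by rewrite invr_eq0.
have q1' k : q^-1 ^+ k.+1 != 1 by rewrite exprVn invr_eq1.
have := masbaum_forward n q0' q1' m0.
move/(congr1 (fun x => q ^+ (m * m) * x)); rewrite mulr0.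
rewrite big_ord_recr /= mulrDr mulr_sumr addrC => E; rewrite -[RHS]E; congr (_ + _).
  rewrite cyclotomic_sum_neg // /forward_coef subnn twist_coef0 mulr1 exprVn.
  have := expf_neq0 (m * m) q0; move: (q ^+ (m * m)) => x x0.
  by field.
by apply: eq_bigr => j _; rewrite cyclotomic_sum_neg // /monic_coef_neg -[(q ^+ n)^-1]exprVn /forward_coef !mulrA.
Qed.
End FinalRecurrences.

Lemma signed_power_neq0 (F : fieldType) (q : F) n k : q != 0 -> (-1) ^+ n * q ^+ k != 0.
Proof. by move=> q0; rewrite mulf_neq0 ?expf_neq0 // oppr_eq0 oner_neq0. Qed.

Lemma cyclotomic_sum_gauge (F : fieldType) (q : F) m n i : cyclotomic_sum q m%:Z (n + i)%N =
  (-1) ^+ n * q ^+ half_n_n3 n * (((-1) ^+ i * q ^+ half_n_n3 i) *: 'X^i).[q ^+ n] * masbaum_sum q m (n + i)%N.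
Proof. by rewrite cyclotomic_sum_pos hornerZ hornerXn half_n_n3_add !exprD exprM; ring. Qed.

Lemma twist_minimal_pos m : (0 < m)%N -> no_small_annihilator (twist_cyclotomic m%:Z) m.
Proof.
move=> m0.
apply: (@gauge_minimal _ (masbaum_sum q_ m) m (fun n => (-1) ^+ n * q_ ^+ half_n_n3 n)
   (fun i => ((-1) ^+ i * q_ ^+ half_n_n3 i) *: 'X^i)); last exact: masbaum_minimal.
- by move=> n; exact: signed_power_neq0 q_neq0.
- move=> i; rewrite -size_poly_eq0 size_scale ?size_polyXn //.
  exact: signed_power_neq0 q_neq0.
move=> n i; exact: cyclotomic_sum_gauge.
Qed.

Lemma twist_minimal_neg m : (0 < m)%N -> no_small_annihilator (twist_cyclotomic (- m%:Z)) m.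
Proof.
move=> m0; apply: (@bar_minimal _ (masbaum_sum q_ m)); last exact: masbaum_minimal.
move=> n; rewrite twist_cyclotomicE (cyclotomic_sum_neg q_neq0 q_not_root_of_unity).
rewrite (masbaum_morph bar); congr (masbaum_sum _ m n).
exact: etrans (fmorphV bar q_) (etrans (congr1 GRing.inv bar_q) (invrK _)).
Qed.

Lemma monic_coef_pos_q1 m j : monic_coef_pos m j Q_ 1 = (- Q_) ^+ (m - j) * twist_coef Q_ 1 m (m - j).
Proof. by rewrite /monic_coef_pos /forward_coef invr1 !expr1n !mulr1 !mul1r. Qed.

Lemma monic_coef_neg_q1 m j : monic_coef_neg m j Q_ 1 = twist_coef Q_^-1 1 m (m - j).
Proof. by rewrite /monic_coef_neg /forward_coef invr1 !expr1n !mul1r. Qed.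

Lemma twist_C_pos m : is_C_polynomial (twist_cyclotomic m.+1%:Z) (twist_C m.+1%:Z).
Proof.
have -> : twist_C m.+1%:Z = 'X^(m.+1) + \sum_(i < m.+1) monic_coef_pos m.+1 i Q_ 1 *: 'X^i.
  rewrite /twist_C /twist_b /=; congr (_ + _); apply: eq_bigr => i _.
  by rewrite monic_coef_pos_q1 -twist_b_posE.
apply: (@is_C_from_family _ _ (monic_coef_pos m.+1)).
- by move=> i _; exact: laurent_monic_coef_pos.
- by move=> n; exact: (cyclotomic_sum_pos_rec q_neq0 q_not_root_of_unity n (ltn0Sn m)).
- exact: twist_minimal_pos.
Qed.

Lemma twist_C_neg m : is_C_polynomial (twist_cyclotomic (- m.+1%:Z)) (twist_C (- m.+1%:Z)).
Proof.
have -> : twist_C (- m.+1%:Z) = 'X^(m.+1) + \sum_(i < m.+1) monic_coef_neg m.+1 i Q_ 1 *: 'X^i.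
  rewrite /twist_C /twist_b /=; congr (_ + _); apply: eq_bigr => i _.
  by rewrite monic_coef_neg_q1 -twist_b_negE.
apply: (@is_C_from_family _ _ (monic_coef_neg m.+1)).
- by move=> i _; exact: laurent_monic_coef_neg.
- by move=> n; exact: (cyclotomic_sum_neg_rec q_neq0 q_not_root_of_unity n (ltn0Sn m)).
- exact: twist_minimal_neg.
Qed.

(** For the unknot the cyclotomic function is supported at 0, so 1 - Q annihilates
    it and the localized ideal is everything. *)
Lemma twist_C_0 : is_C_polynomial (twist_cyclotomic 0) (twist_C 0).
Proof.
have v0 : 1 - 'X != 0 :> {poly Qq} by rewrite -opprB oppr_eq0 -polyC1 polyXsubC_eq0.
exists 1; split.
- apply: (@characteristic_of_minimal _ (skew_monomial qshift (1 - 'X) 0) 1 (tofrac (1 - 'X))).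
  + move=> n; rewrite -[skew_monomial _ _ _]mulr1 act_skew_monomial_mul addn0.
    have -> : act (1 : Aq) (twist_cyclotomic 0) n = twist_cyclotomic 0 n.
      by rewrite (@act_horner 1) ?size_poly1 // big_ord1 coef1 hornerC mul1r addn0.
    rewrite twist_cyclotomicE (@cyclotomic_sum_pos _ _ 0%N); case: n => [|n].
      have -> : (1 - 'X : {poly Qq}).[q_ ^+ 0] = 0 by rewrite !hornerE expr0 subrr.
      exact: mul0r.
    have := masbaum_rec q_neq0 q_not_root_of_unity (leq0n n.+1) (ltn0Sn n).
    rewrite /twist_op big_ord1 subn0 twist_coef0 mul0n expr0 invr1 !mul1r => ->.
    by rewrite !mulr0.
  + by rewrite skew_monomial0 polyC_eq0.
  + move=> P _; rewrite skew_monomial0 size_polyC v0 ltnS leqn0 size_poly_eq0 => /eqP. exact.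
  + by rewrite tofrac_eq0.
  by rewrite Aq_loc_skew_monomial mulr1.
- exact: lead_coef1.
have tw : twist_C 0 = 1 by rewrite /twist_C /= big_ord0 addr0 expr0.
move=> i; rewrite tw [(1 : Aloc)`_i]coef1 [(1 : {poly QQ})`_i]coef1; case: (i == 0%N).
- exact: (laurent_specializes laurent1).
- exact: (laurent_specializes laurent0).
Qed.

Theorem corollary1p4 (p : int) : is_C_polynomial (twist_cyclotomic p) (twist_C p).
Proof.
case: p => [[|m]|m]; [exact: twist_C_0 | exact: twist_C_pos |].
by rewrite NegzE; exact: twist_C_neg.
Qed.
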